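(* Let $K$ be a perfect field and let $R$ be an integral domain which is a finitely generated $K$-algebra and a regular ring. Then every finitely generated $R$-module $M$ with a higher connection $\nabla$ is a projective $R$-module.
   Context: $\hat\Omega=\hat\Omega_{R/K}$ (the algebra of higher differentials) is the completion, with respect to the filtration by degree, of the graded commutative $R$-algebra generated by symbols $d^{(k)}r$ ($k\ge1$, $r\in R$), of degree $k$, modulo the relations $d^{(k)}(r+s)=d^{(k)}r+d^{(k)}s$, $d^{(k)}a=0$ for $a\in K$, and $d^{(k)}(rs)=\sum_{i=0}^kd^{(i)}r\,d^{(k-i)}s$ (with $d^{(0)}r:=r$). Thus $\hat\Omega=\prod_{k\ge0}\hat\Omega_k$ with $\hat\Omega_0=R$. Let $d_R:R\to\hat\Omega$, $d_R(r)=\sum_{k\ge0}d^{(k)}r$, a homomorphism of $K$-algebras. For an $R$-module $M$, $\hat\Omega\otimes_RM$ denotes $\prod_k\hat\Omega_k\otimes_RM$. A higher connection on $M$ is an additive map $\nabla:M\to\hat\Omega\otimes_RM$ with $\nabla(rm)=d_R(r)\nabla(m)$ for all $r\in R,m\in M$, whose degree-$0$ component $M\to \hat\Omega_0\otimes_R M=M$ is $\mathrm{id}_M$. *)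

(* Defs.v *)
(* Classical reasoning ([boolp.asbool], written `[< P >]) turns arbitrary
   propositions into booleans.  In particular the library's boolean ideals
   ([idealr], [prime_idealr]) range over all (prime) ideals. *)
From HB Require Import structures.
From mathcomp Require Import all_boot all_order all_algebra.
From mathcomp Require Import finmap separable generic_quotient.
From mathcomp Require Import boolp.
From mathcomp Require Import monalg.
From mathcomp Require mpoly.

Set Implicit Arguments.
Unset Strict Implicit.
Unset Printing Implicit Defensive.

Import GRing.Theory.

Local Open Scope ring_scope.
Local Open Scope quotient_scope.

Definition perfect_field (K : fieldType) : Prop :=
  forall p : {poly K}, irreducible_poly p -> separable_poly p.

(* A K-algebra structure on a commutative ring R is a ring morphism
   [iota : K -> R]. *)
Definition fg_algebra (K : fieldType) (R : comNzRingType)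
    (iota : {rmorphism K -> R}) : Prop :=
  exists (n : nat) (x : 'I_n -> R),
    forall r : R, exists p : mpoly.mpoly n K, r = mpoly.mmap iota x p.

Definition fg_module (R : nzRingType) (M : lmodType R) : Prop :=
  exists (n : nat) (g : 'I_n -> M),
    forall m : M, exists c : 'I_n -> R, m = \sum_i c i *: g i.

Definition projective (R : nzRingType) (P : lmodType R) : Prop :=
  forall (A B : lmodType R) (f : {linear A -> B}) (g : {linear P -> B}),
    (forall b : B, exists a : A, f a = b) ->
    exists h : {linear P -> A}, forall x : P, f (h x) = g x.

Section RegularLocal.
Variable A : comNzRingType.

Definition generated_by (n : nat) (x : 'I_n -> A) (I : idealr A) : Prop :=
  forall a : A, a \in I <-> exists c : 'I_n -> A, a = \sum_i c i * x i.

(* [idealr A] consists of the proper ideals; the unit ideal is generated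
   by 1. *)
Definition noetherian : Prop :=
  forall I : idealr A, exists (n : nat) (x : 'I_n -> A), generated_by x I.

Definition maximal_ideal (m : idealr A) : Prop :=
  forall J : idealr A, {subset m <= J} -> {subset J <= m}.

Definition prime_lt (P Q : prime_idealr A) : Prop :=
  {subset P <= Q} /\ ~ {subset Q <= P}.

(* P_0 < P_1 < ... < P_n *)
Definition prime_chain (n : nat) : Prop :=
  exists P : 'I_n.+1 -> prime_idealr A,
    forall i j : 'I_n.+1, (i < j)%N -> prime_lt (P i) (P j).

Definition krull_dim (d : nat) : Prop :=
  prime_chain d /\ forall n : nat, prime_chain n -> (n <= d)%N.

Definition regular_local : Prop :=
  noetherian /\
  exists m : idealr A,
    [/\ maximal_ideal m,
        (forall m' : idealr A, maximal_ideal m' -> m' =i m) &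
        exists (d : nat) (x : 'I_d -> A), krull_dim d /\ generated_by x m].

End RegularLocal.

Section Localization.
Local Notation "x %:F" := (@FracField.tofrac _ x).
Variables (R : idomainType) (P : prime_idealr R).

Definition localization_pred (x : {fraction R}) : bool :=
  `[< exists a s : R, s \notin P /\ x = a%:F / s%:F >].

Fact localization_subring : subring_closed localization_pred.
Proof.
have nz (s : R) : s \notin P -> s%:F != 0 :> {fraction R}.
  by rewrite tofrac_eq0; apply: contraNneq => ->; exact: idealr0.
have nM (s t : R) : s \notin P -> t \notin P -> s * t \notin P.
  by move=> sP tP; rewrite prime_idealrM negb_or sP.
split.
- apply/asboolP; exists 1, 1; split; first by rewrite idealr1.
  by rewrite tofrac1 divr1.
- move=> x y /asboolP[a [s [sP ->]]] /asboolP[b [t [tP ->]]]; apply/asboolP.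
  exists (a * t - b * s), (s * t); split; first exact: nM.
  by rewrite tofracB !tofracM -mulNr addf_div ?nz // mulNr.
- move=> x y /asboolP[a [s [sP ->]]] /asboolP[b [t [tP ->]]]; apply/asboolP.
  exists (a * b), (s * t); split; first exact: nM.
  by rewrite !tofracM mulf_div.
Qed.

HB.instance Definition _ :=
  GRing.isSubringClosed.Build {fraction R} localization_pred
    localization_subring.

(* R_P, as the subring of Frac R of the fractions a / s with s outside P *)
Record localization : Type := Localization {
  localization_val : {fraction R};
  localization_valP : localization_val \in localization_pred }.

HB.instance Definition _ := [isSub for localization_val].
HB.instance Definition _ := [Choice of localization by <:].
HB.instance Definition _ := [SubChoice_isSubComNzRing of localization by <:].

End Localization.

Definition regular_ring (R : idomainType) : Prop :=
  noetherian R /\ forall P : prime_idealr R, regular_local (localization P).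

Section TensorProduct.
Variables (R : nzRingType) (N M : lmodType R).

Local Notation pairs := {malg int[(N * M)%type]}.

Variant tensor_rel : pairs -> Prop :=
| TensorAddl n n' m :
    tensor_rel (<< (n + n', m) >> - (<< (n, m) >> + << (n', m) >>))
| TensorAddr n m m' :
    tensor_rel (<< (n, m + m') >> - (<< (n, m) >> + << (n, m') >>))
| TensorScale r n m :
    tensor_rel (<< (r *: n, m) >> - << (n, r *: m) >>).

(* the subgroup generated by the relations *)
Definition tensor_null (x : pairs) : bool :=
  `[< exists s : seq (int * pairs),
        (forall c, c \in s -> tensor_rel c.2) /\
        x = \sum_(c <- s) c.1 *: c.2 >].

Fact tensor_null_zmod : zmod_closed tensor_null.
Proof.
split; first by apply/asboolP; exists [::]; rewrite big_nil.
move=> x y /asboolP[s [sP ->]] /asboolP[t [tP ->]]; apply/asboolP.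
exists (s ++ [seq (- c.1, c.2) | c <- t]); split.
  by move=> c; rewrite mem_cat => /orP[/sP //|/mapP[e /tP ? ->]].
rewrite big_cat big_map /= -sumrN; congr (_ + _).
by apply: eq_bigr => c _; rewrite scaleNr.
Qed.

HB.instance Definition _ :=
  GRing.isZmodClosed.Build pairs tensor_null tensor_null_zmod.

Definition tensor_nulls : zmodClosed pairs :=
  GRing.ZmodClosed.clone _ tensor_null _.

(* N \otimes_R M as an abelian group; R is commutative in all uses. *)
Definition tensor : Type := Quotient.quot tensor_nulls.

HB.instance Definition _ := GRing.Zmodule.on tensor.

Definition tensor_class (x : pairs) : tensor :=
  \pi_(Quotient.quot tensor_nulls) x.

Definition tensor_repr (t : tensor) : pairs :=
  repr (t : Quotient.quot tensor_nulls).

Fact tensor_class_is_zmod_morphism : zmod_morphism tensor_class.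
Proof. exact: (pi_is_zmod_morphism (Quotient.quot tensor_nulls)). Qed.

HB.instance Definition _ := GRing.isZmodMorphism.Build pairs tensor
  tensor_class tensor_class_is_zmod_morphism.

Fact tensor_reprK : cancel tensor_repr tensor_class.
Proof. exact: (@reprK _ (Quotient.quot tensor_nulls)). Qed.

Fact tensor_classP (x y : pairs) :
  tensor_class x = tensor_class y <-> x - y \in tensor_nulls.
Proof.
by rewrite Quotient.idealrBE; split => [xy|/eqP//]; apply/eqP.
Qed.

Definition tens (n : N) (m : M) : tensor := tensor_class << (n, m) >>.

Fact tens_eq (x y : pairs) :
  tensor_rel (x - y) -> tensor_class x = tensor_class y.
Proof.
move=> xy; apply/tensor_classP/asboolP; exists [:: (1, x - y)]; split.
  by move=> c; rewrite inE => /eqP->.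
by rewrite big_seq1 scale1r.
Qed.

Fact tensDl n n' m : tens (n + n') m = tens n m + tens n' m.
Proof. by rewrite -(raddfD tensor_class); apply: tens_eq; exact: TensorAddl. Qed.

Fact tensDr n m m' : tens n (m + m') = tens n m + tens n m'.
Proof. by rewrite -(raddfD tensor_class); apply: tens_eq; exact: TensorAddr. Qed.

Fact tensZ r n m : tens (r *: n) m = tens n (r *: m).
Proof. by apply: tens_eq; exact: TensorScale. Qed.

End TensorProduct.

Section TensorMap.
Variables (R : nzRingType) (N N' M : lmodType R).

Definition free_map (f : N -> N') (p : {malg int[(N * M)%type]}) : tensor N' M :=
  \sum_(u <- msupp p) tens (f u.1) u.2 *~ mcoeff u p.

(* f \otimes id_M, computed on a representative; well defined for linear f,
   see [tensor_map_is_zmod_morphism] and [tensor_map_tens]. *)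
Definition tensor_map (f : {linear N -> N'}) (t : tensor N M) :
  tensor N' M := free_map f (tensor_repr t).

Variable f : {linear N -> N'}.

Fact free_mapEw (d : {fset (N * M)%type}) (p : {malg int[(N * M)%type]}) :
  (msupp p `<=` d)%fset ->
  free_map f p = \sum_(u <- d) tens (f u.1) u.2 *~ mcoeff u p.
Proof.
move=> le; rewrite /free_map (big_fset_incl _ le) // => u _ /mcoeff_outdom->.
by rewrite mulr0z.
Qed.

Fact free_map_is_zmod_morphism : zmod_morphism (free_map f).
Proof.
move=> p q; pose d := (msupp p `|` msupp q)%fset.
rewrite !(@free_mapEw d) ?fsubsetUl ?fsubsetUr ?msuppB_le //.
by rewrite -sumrB; apply: eq_bigr => u _; rewrite mcoeffB mulrzBr.
Qed.

HB.instance Definition _ := GRing.isZmodMorphism.Build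
  {malg int[(N * M)%type]} (tensor N' M) (free_map f) free_map_is_zmod_morphism.

Fact free_mapU u : free_map f << u >> = tens (f u.1) u.2.
Proof. by rewrite /free_map msuppU oner_eq0 big_seq_fset1 mcoeffUU. Qed.

Fact free_map_rel p : tensor_rel p -> free_map f p = 0.
Proof.
case=> [n n' m|n m m'|r n m]; rewrite (raddfB (free_map f)) /= free_mapU /=.
- by rewrite (raddfD (free_map f)) /= !free_mapU /= linearD tensDl subrr.
- by rewrite (raddfD (free_map f)) /= !free_mapU /= tensDr subrr.
- by rewrite free_mapU /= linearZ /= tensZ subrr.
Qed.

Fact tensor_map_class p : tensor_map f (tensor_class p) = free_map f p.
Proof.
apply/eqP; rewrite -subr_eq0 -(raddfB (free_map f)); apply/eqP.
have /tensor_classP/asboolP[s [sP ->]] := tensor_reprK (tensor_class p).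
rewrite raddf_sum big_seq big1 // => c /sP /free_map_rel c0.
by rewrite -[c.1]intz scaler_int raddfMz /= c0 mul0rz.
Qed.

Fact tensor_map_is_zmod_morphism : zmod_morphism (tensor_map f).
Proof.
move=> x y; rewrite -[x]tensor_reprK -[y]tensor_reprK.
by rewrite -(raddfB (@tensor_class _ _ _)) !tensor_map_class raddfB.
Qed.

HB.instance Definition _ := GRing.isZmodMorphism.Build
  (tensor N M) (tensor N' M) (tensor_map f) tensor_map_is_zmod_morphism.

Fact tensor_map_tens n m : tensor_map f (tens n m) = tens (f n) m.
Proof. by rewrite tensor_map_class free_mapU. Qed.

End TensorMap.

(* the ideal of A generated by S *)
Definition ideal_span (A : comNzRingType) (S : A -> Prop) (x : A) : bool :=
  `[< exists s : seq (A * A),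
        (forall c, c \in s -> S c.2) /\ x = \sum_(c <- s) c.1 * c.2 >].

Fact ideal_span_closed (A : comNzRingType) (S : A -> Prop) (a x y : A) :
  ideal_span S x -> ideal_span S y -> ideal_span S (a * x + y).
Proof.
move=> /asboolP[s [sP ->]] /asboolP[t [tP ->]]; apply/asboolP.
exists ([seq (a * c.1, c.2) | c <- s] ++ t); split.
  by move=> c; rewrite mem_cat => /orP[/mapP[e /sP ? ->]|/tP].
rewrite big_cat big_map mulr_sumr /=; congr (_ + _).
by apply: eq_bigr => c _; rewrite mulrA.
Qed.

Section HigherDifferentials.
Variables (K : fieldType) (R : comNzRingType) (iota : {rmorphism K -> R}).

(* The variable indexed by (k, r) stands for the symbol d^(k+1) r. *)
Local Notation mon := {cmonom (nat * R)%type}.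
Local Notation poly := {malg R[mon]}.

Definition hd_symbol (k : nat) (r : R) : poly :=
  if k is j.+1 then << ucm (j, r) >> else r%:MP.

Variant hd_rel : poly -> Prop :=
| HdAdd k r s :
    hd_rel (hd_symbol k.+1 (r + s) - (hd_symbol k.+1 r + hd_symbol k.+1 s))
| HdConst k a : hd_rel (hd_symbol k.+1 (iota a))
| HdMul k r s :
    hd_rel (hd_symbol k.+1 (r * s) -
            \sum_(i < k.+2) hd_symbol i r * hd_symbol (k.+1 - i) s).

Definition hd_null (p : poly) : bool := ideal_span hd_rel p.

Let aug (p : poly) : R := mcoeff (mone : mon) p.

Fact aug1 : aug 1 = 1.
Proof. exact: (rmorph1 (@mcoeff mon R mone)). Qed.

Fact augM p q : aug (p * q) = aug p * aug q.
Proof. exact: (rmorphM (@mcoeff mon R mone)). Qed.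

Fact augB p q : aug (p - q) = aug p - aug q.
Proof. exact: mcoeffB. Qed.

Fact aug_sum (I : Type) (s : seq I) (F : I -> poly) :
  aug (\sum_(i <- s) F i) = \sum_(i <- s) aug (F i).
Proof. exact: (raddf_sum (@mcoeff mon R mone)). Qed.

Fact aug_symbol k r : (0 < k)%N -> aug (hd_symbol k r) = 0.
Proof. by case: k => // k _; rewrite /aug /= mcoeffU1 cm1_eq1. Qed.

Fact aug_rel p : hd_rel p -> aug p = 0.
Proof.
case=> [k r s|k a|k r s]; last 2 first.
- exact: aug_symbol.
- rewrite augB aug_symbol // sub0r aug_sum big1 ?oppr0 // => i _.
  rewrite augM; have [i0|i0] := posnP i.
    by rewrite [X in _ * X]aug_symbol ?mulr0 // i0.
  by rewrite [X in X * _]aug_symbol ?mul0r.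
rewrite opprD addrA !augB [X in _ - X]aug_symbol // [X in _ - X - _]aug_symbol //.
by rewrite [X in X - _ - _]aug_symbol // !subr0.
Qed.

Fact hd_null_idealr : idealr_closed hd_null.
Proof.
split; first by apply/asboolP; exists [::]; rewrite big_nil.
  apply/asboolP => -[s [sP]] /(congr1 aug) /eqP.
  rewrite aug1 aug_sum big_seq big1 ?oner_eq0 // => c /sP /aug_rel c0.
  by rewrite augM c0 mulr0.
by move=> a p q; exact: ideal_span_closed.
Qed.

HB.instance Definition _ := isIdealr.Build poly hd_null hd_null_idealr.

Definition hd_ideal : idealr poly := Idealr.clone _ hd_null _.

Definition Omega : Type := {ideal_quot hd_ideal}.

HB.instance Definition _ := GRing.ComNzRing.on Omega.

Definition Omega_class (p : poly) : Omega := \pi_({ideal_quot hd_ideal}) p.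

Fact Omega_class_is_zmod_morphism : zmod_morphism Omega_class.
Proof. exact: (pi_is_zmod_morphism {ideal_quot hd_ideal}). Qed.

HB.instance Definition _ := GRing.isZmodMorphism.Build poly Omega
  Omega_class Omega_class_is_zmod_morphism.

Fact Omega_class_is_monoid_morphism : monoid_morphism Omega_class.
Proof. exact: (pi_is_monoid_morphism {ideal_quot hd_ideal}). Qed.

HB.instance Definition _ := GRing.isMonoidMorphism.Build poly Omega
  Omega_class Omega_class_is_monoid_morphism.

Definition Omega_const (r : R) : Omega := Omega_class r%:MP.

Fact Omega_constD r s : Omega_const (r + s) = Omega_const r + Omega_const s.
Proof.
by apply: etrans (raddfD Omega_class _ _); congr Omega_class; exact: raddfD.
Qed.

Fact Omega_constM r s : Omega_const (r * s) = Omega_const r * Omega_const s.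
Proof.
by apply: etrans (rmorphM Omega_class _ _); congr Omega_class; exact: rmorphM.
Qed.

Fact Omega_const1 : Omega_const 1 = 1.
Proof. exact: (rmorph1 Omega_class). Qed.

Definition Omega_scale (r : R) (x : Omega) : Omega := Omega_const r * x.

Fact Omega_scaleA r s x :
  Omega_scale r (Omega_scale s x) = Omega_scale (r * s) x.
Proof. by rewrite /Omega_scale Omega_constM mulrA. Qed.

Fact Omega_scale1 : left_id 1 Omega_scale.
Proof. by move=> x; rewrite /Omega_scale Omega_const1 mul1r. Qed.

Fact Omega_scaleDr : right_distributive Omega_scale +%R.
Proof. by move=> r x y; rewrite /Omega_scale mulrDr. Qed.

Fact Omega_scaleDl x : {morph Omega_scale^~ x : r s / r + s}.
Proof. by move=> r s; rewrite /Omega_scale Omega_constD mulrDl. Qed.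

HB.instance Definition _ := GRing.Zmodule_isLmodule.Build R Omega
  Omega_scaleA Omega_scale1 Omega_scaleDr Omega_scaleDl.

(* the degree for which d^(k) r has degree k *)
Definition wdeg (m : mon) : nat := (\sum_(v <- finsupp m) m v * v.1.+1)%N.

Definition homogeneous (k : nat) (p : poly) : Prop :=
  forall m : mon, m \in msupp p -> wdeg m = k.

Fact wdegEw (m : mon) (d : {fset (nat * R)%type}) :
  (finsupp m `<=` d)%fset -> wdeg m = (\sum_(v <- d) m v * v.1.+1)%N.
Proof.
move=> le; rewrite /wdeg (big_fset_incl _ le) // => v _.
by rewrite -cmE_neq0 negbK => /eqP->.
Qed.

Fact wdegM (m1 m2 : mon) : wdeg (mmul m1 m2) = (wdeg m1 + wdeg m2)%N.
Proof.
rewrite (@wdegEw m1 (finsupp (mmul m1 m2))) ?mdomD ?fsubsetUl //.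
rewrite (@wdegEw m2 (finsupp (mmul m1 m2))) ?mdomD ?fsubsetUr //.
rewrite /wdeg -mdomD -big_split; apply: eq_bigr => v _ /=.
by rewrite cmM mulnDl.
Qed.

Fact homogeneousM j k p q :
  homogeneous j p -> homogeneous k q -> homogeneous (j + k) (p * q).
Proof.
move=> hp hq m /msuppM_le[m1 [m2 [/hp <- /hq <- ->]]]; exact: wdegM.
Qed.

Fact homogeneousB k p q :
  homogeneous k p -> homogeneous k q -> homogeneous k (p - q).
Proof.
move=> hp hq m /(fsubsetP (msuppB_le p q)); rewrite in_fsetU.
by case/orP => [/hp|/hq].
Qed.

Fact homogeneous_symbol k r : homogeneous k (hd_symbol k r).
Proof.
case: k => [|k] m /=.
  move/(fsubsetP (msuppC_le r)); rewrite in_fset1 => /eqP->.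
  by rewrite /wdeg mdom1 big_seq_fset0.
rewrite msuppU1 in_fset1 => /eqP->.
by rewrite /wdeg mdomU big_seq_fset1 cmUU mul1n.
Qed.

Definition Omega_pred (k : nat) (x : Omega) : bool :=
  `[< exists p : poly, homogeneous k p /\ x = Omega_class p >].

Fact Omega_submod k : submod_closed (Omega_pred k).
Proof.
have h0 : homogeneous k 0 by move=> m; rewrite msupp0 in_fset0.
split; first by apply/asboolP; exists 0; rewrite raddf0.
move=> r x y /asboolP[p [hp ->]] /asboolP[q [hq ->]]; apply/asboolP.
exists (r%:MP * p - (0 - q)); split.
  apply: homogeneousB; last exact: homogeneousB.
  rewrite -[k]add0n; apply: homogeneousM hp; exact: homogeneous_symbol 0 r.
rewrite sub0r opprK (raddfD Omega_class); congr (_ + _).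
exact: esym (rmorphM Omega_class _ _).
Qed.

HB.instance Definition _ k :=
  GRing.isSubmodClosed.Build R Omega (Omega_pred k) (Omega_submod k).

(* the image of the homogeneous polynomials of degree k: the degree k component
   of Omega, hence also of its completion *)
Record Omega_ (k : nat) : Type := OmegaElt {
  Omega_val : Omega;
  Omega_valP : Omega_val \in Omega_pred k }.

HB.instance Definition _ k := [isSub for @Omega_val k].
HB.instance Definition _ k := [Choice of Omega_ k by <:].
HB.instance Definition _ k := [SubChoice_isSubLmodule of Omega_ k by <:].

Fact hd_proof k r : Omega_class (hd_symbol k r) \in Omega_pred k.
Proof.
by apply/asboolP; exists (hd_symbol k r); split=> //; exact: homogeneous_symbol.
Qed.

(* d^(k) r; for k = 0 this is the identification of R with Omega_0 *)
Definition hd (k : nat) (r : R) : Omega_ k := OmegaElt (hd_proof k r).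

Fact Omega_mul_proof k (i : 'I_k.+1) (x : Omega_ i) (y : Omega_ (k - i)) :
  Omega_val x * Omega_val y \in Omega_pred k.
Proof.
case: x y => [_ /= /asboolP[p [hp ->]]] [_ /= /asboolP[q [hq ->]]].
apply/asboolP; exists (p * q); split; last first.
  exact: esym (rmorphM Omega_class _ _).
by rewrite -(subnKC (leq_ord i)); exact: homogeneousM.
Qed.

(* the product Omega_i * Omega_(k - i) -> Omega_k *)
Definition Omega_mul k (i : 'I_k.+1) (x : Omega_ i) (y : Omega_ (k - i)) :
  Omega_ k := OmegaElt (Omega_mul_proof x y).

Fact Omega_mul_is_linear k (i : 'I_k.+1) (x : Omega_ i) :
  linear (Omega_mul x).
Proof.
move=> r y z; apply: val_inj; rewrite /= mulrDr; congr (_ + _).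
exact: mulrCA.
Qed.

HB.instance Definition _ k (i : 'I_k.+1) (x : Omega_ i) :=
  GRing.isLinear.Build R (Omega_ (k - i)) (Omega_ k) *:%R (Omega_mul x)
    (Omega_mul_is_linear x).

(* the completion of Omega for the degree filtration, as a product *)
Definition Omegahat : Type := forall k : nat, Omega_ k.

Definition d_R (r : R) : Omegahat := fun k => hd k r.

Variable M : lmodType R.

Definition Omegahat_tensor : Type := forall k : nat, tensor (Omega_ k) M.

(* the action of Omegahat on Omegahat \otimes M *)
Definition Omegahat_act (w : Omegahat) (t : Omegahat_tensor) :
    Omegahat_tensor :=
  fun k => \sum_(i < k.+1) tensor_map (Omega_mul (w i)) (t (k - i)%N).

Definition higher_connection (nabla : M -> Omegahat_tensor) : Prop :=
  [/\ forall (m m' : M) (k : nat), nabla (m + m') k = nabla m k + nabla m' k,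
      forall (r : R) (m : M) (k : nat),
        nabla (r *: m) k = Omegahat_act (d_R r) (nabla m) k &
      forall m : M, nabla m 0%N = tens (hd 0 1) m].

End HigherDifferentials.

(* Main.v *)
(* Let m be a maximal ideal of R. By Zariski's lemma R/m is finite over K, and
   as K is perfect, Hensel's lemma yields a coefficient field in R/m^N. For a
   regular system of parameters x the monomials of degree < N in x are then
   linearly independent over it: a relation would bound dim R/m^n by
   O(n^(d-1)), whereas a chain of d + 1 primes forces growth of order n^d (this
   is proved with Artin-Rees). So R/m^N is a graded ring, and the grading is a
   higher derivation phi : R -> A[t], where A = R/m^N, whose constant term
   factors through R/m and whose kernel is m^N.
   By the universal property of Omega, the connection turns phi into a higher
   derivation psi : M -> (A \otimes_R M)[[t]] over phi with psi_0(x) = 1 \otimes x.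
   Lift a basis of M/mM to v_1, ..., v_n in M. If \sum_i c_i v_i = 0, then
   \sum_i phi(c_i) psi(v_i) = 0, where the constant terms of the psi(v_i) form a
   basis, so phi(c_i) = 0 and c_i lies in m^N. This holds for all N, so c_i = 0
   by Krull's intersection theorem, and the v_i form a basis of M near m. Hence
   the ideal of all s such that multiplication by s on M factors through a
   finite free module lies in no maximal ideal. *)
Require Import Defs.
From HB Require Import structures.
From mathcomp Require Import all_boot all_order all_algebra.
From mathcomp Require Import finmap separable generic_quotient.
From mathcomp Require Import boolp classical_sets ring zify.
From mathcomp Require Import mpoly.
From mathcomp Require monalg.

Set Implicit Arguments.
Unset Strict Implicit.
Unset Printing Implicit Defensive.

Import Order.TTheory GRing.Theory.

Local Open Scope ring_scope.

(** * Ideals as predicates *)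

(** A single derivation does not suffice in characteristic p, since it kills p-th powers; the
    components of the grading together detect every element outside m^N. That the constant term of
    the higher derivation kills m is decisive: coordinates with respect to the v_i are at first
    determined only modulo m, yet composed with that constant term they are well-defined functions
    on M. The connection can thus be paired with a coordinate function before freeness is known.
    Dimensions are counted over K, since R/m is finite over K, and only orders of growth are
    compared, so that no Hilbert polynomial is needed. Perfectness enters once, through the
    separability of minimal polynomials over K, which Newton's iteration requires. The local rings
    serve only to supply parameters and a chain of primes; both are brought back to R, where an
    element outside m is inverted modulo a power of m. *)

Section Ideals.
Variable R : comNzRingType.
Implicit Types (I J P m : R -> Prop) (a b x : R).

(** Unlike [idealr], this admits the unit ideal, which occurs as m^0 and in sums such as P + m^0. *)
Record is_ideal I : Prop := IsIdeal {
  ideal0 : I 0;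
  idealD : forall a b, I a -> I b -> I (a + b);
  idealMl : forall r a, I a -> I (r * a) }.

Record is_prime P : Prop := IsPrime {
  prime_ideal : is_ideal P;
  prime_proper : ~ P 1;
  primeM : forall a b, P (a * b) -> P a \/ P b }.

Record is_maximal m : Prop := IsMaximal {
  maximal_is_ideal : is_ideal m;
  maximal_proper : ~ m 1;
  maximal_inv : forall a, ~ m a -> exists u, m (1 - u * a) }.

Definition ideal_add I J x := exists2 a, I a & J (x - a).

Definition ideal_mul I J x :=
  exists s : seq (R * R),
    (forall c, c \in s -> I c.1 /\ J c.2) /\ x = \sum_(c <- s) c.1 * c.2.

Fixpoint ideal_exp I n : R -> Prop :=
  if n is k.+1 then ideal_mul I (ideal_exp I k) else fun=> True.

Section OneIdeal.
Variable I : R -> Prop.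
Hypothesis idI : is_ideal I.

Lemma ideal_Mr r a : I a -> I (a * r).
Proof. by rewrite mulrC; exact: idealMl. Qed.

Lemma idealN a : I a -> I (- a).
Proof. by rewrite -mulN1r; exact: idealMl. Qed.

Lemma idealB a b : I a -> I b -> I (a - b).
Proof. by move=> Ia Ib; apply: idealD => //; exact: idealN. Qed.

Lemma ideal_sum (T : Type) (s : seq T) (P : pred T) (F : T -> R) :
  (forall i, P i -> I (F i)) -> I (\sum_(i <- s | P i) F i).
Proof.
by move=> IF; elim/big_ind: _ => //; [exact: ideal0|exact: idealD].
Qed.

Lemma ideal_sum_seq (T : eqType) (s : seq T) (F : T -> R) :
  (forall i, i \in s -> I (F i)) -> I (\sum_(i <- s) F i).
Proof. by move=> IF; rewrite big_seq; exact: ideal_sum. Qed.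

Lemma idealBC a b : I (a - b) -> I (b - a).
Proof. by move/idealN; rewrite opprB. Qed.

Lemma ideal_trans a b c : I (a - b) -> I (b - c) -> I (a - c).
Proof. by move=> ab bc; rewrite -(subrKA b); exact: idealD. Qed.

Lemma ideal_congr a b : I (a - b) -> I b -> I a.
Proof. by move=> ab Ib; rewrite -(subrK b a); exact: idealD. Qed.

End OneIdeal.

Lemma maximal_is_prime m : is_maximal m -> is_prime m.
Proof.
move=> [idm m1 inv]; split=> // a b mab.
have [?|na] := pselect (m a); [by left|right].
have [u mu] := inv a na.
apply: (ideal_congr idm (b := u * (a * b))); last exact: idealMl.
by rewrite mulrA -{1}[b]mul1r -mulrBl; exact: ideal_Mr.
Qed.

Lemma ideal_mul_ideal I J : is_ideal I -> is_ideal J -> is_ideal (ideal_mul I J).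
Proof.
move=> idI idJ; split; first by exists [::]; rewrite big_nil.
- move=> _ _ [s [sP ->]] [t [tP ->]]; exists (s ++ t); rewrite big_cat; split=> //.
  by move=> c; rewrite mem_cat => /orP[/sP|/tP].
- move=> r _ [s [sP ->]]; exists [seq (r * c.1, c.2) | c <- s]; split.
    by move=> c /mapP[e /sP[? ?] ->]; split=> //; exact: idealMl.
  by rewrite big_map mulr_sumr; apply: eq_bigr => c _; rewrite mulrA.
Qed.

Lemma ideal_exp_ideal I n : is_ideal I -> is_ideal (ideal_exp I n).
Proof. by move=> idI; elim: n => [|n IH] //=; exact: ideal_mul_ideal. Qed.

Lemma ideal_mul_mem I J a b : I a -> J b -> ideal_mul I J (a * b).
Proof.
move=> Ia Jb; exists [:: (a, b)]; rewrite big_seq1; split=> //.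
by move=> c; rewrite inE => /eqP->.
Qed.

Lemma ideal_exp_mul I i j a b : is_ideal I ->
  ideal_exp I i a -> ideal_exp I j b -> ideal_exp I (i + j) (a * b).
Proof.
move=> idI; elim: i a => [|i IH] a.
  by move=> _; apply: idealMl; exact: ideal_exp_ideal.
move=> [s [sP ->]] Jb; rewrite mulr_suml addSn.
apply: ideal_sum_seq; first exact: (ideal_exp_ideal (i + j).+1 idI).
move=> c /sP[Ic Jc]; rewrite -mulrA; apply: ideal_mul_mem => //; exact: IH.
Qed.

Lemma ideal_expS I n a : is_ideal I -> ideal_exp I n.+1 a -> ideal_exp I n a.
Proof.
move=> idI [s [sP ->]]; apply: ideal_sum_seq; first exact: ideal_exp_ideal.
by move=> c /sP[Ic Jc]; apply: idealMl => //; exact: ideal_exp_ideal.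
Qed.

Lemma ideal_exp_le I n k a : is_ideal I -> (k <= n)%N ->
  ideal_exp I n a -> ideal_exp I k a.
Proof.
move=> idI /subnKC <-; elim: (n - k)%N => [|j IH]; first by rewrite addn0.
by rewrite addnS => /(ideal_expS idI).
Qed.

Lemma ideal_exp1 I a : is_ideal I -> ideal_exp I 1 a <-> I a.
Proof.
move=> idI; split=> [[s [sP ->]]|Ia].
  by apply: ideal_sum_seq => // c /sP[? _]; exact: ideal_Mr.
by rewrite -[a]mulr1; exact: ideal_mul_mem.
Qed.

Lemma ideal_exp_X I a n : is_ideal I -> I a -> ideal_exp I n (a ^+ n).
Proof.
move=> idI Ia; elim: n => // n IH; rewrite exprS; exact: ideal_mul_mem.
Qed.

Lemma ideal_add_ideal I J : is_ideal I -> is_ideal J -> is_ideal (ideal_add I J).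
Proof.
move=> idI idJ; split.
- by exists 0; [exact: ideal0|rewrite subr0; exact: ideal0].
- move=> a b [a' Ia Ja] [b' Ib Jb]; exists (a' + b'); first exact: idealD.
  by rewrite opprD addrACA; exact: idealD.
- move=> r a [a' Ia Ja]; exists (r * a'); first exact: idealMl.
  by rewrite -mulrBr; exact: idealMl.
Qed.

Lemma maximal_inv_exp m n a : is_maximal m -> ~ m a ->
  exists u, ideal_exp m n (1 - u * a).
Proof.
move=> [idm _ inv] /inv[u mu].
have E := subrX1 (1 - u * a) n; move: E (ideal_exp_X n idm mu).
set S := \sum_(i < n) _; set b := _ ^+ n => E mb; exists (S * u).
suff -> : 1 - S * u * a = b by [].
by rewrite -[b](subrK 1) E; ring.
Qed.

Lemma maximal_above I : is_ideal I -> ~ I 1 ->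
  exists2 m, is_maximal m & forall a, I a -> m a.
Proof.
move=> idI I1.
pose T := {J : R -> Prop | is_ideal J /\ ~ J 1 /\ forall a, I a -> J a}.
pose le (J J' : T) := `[< forall a, sval J a -> sval J' a >].
have I0 : is_ideal I /\ ~ I 1 /\ forall a, I a -> I a by [].
have [] := @Zorn T le.
- by move=> J; apply/asboolP.
- by move=> J1 J2 J3 /asboolP h12 /asboolP h23; apply/asboolP => a /h12/h23.
- move=> [J1 p1] [J2 p2] /asboolP /= h12 /asboolP /= h21.
  have E : J1 = J2 by apply/funext => a; apply/propext; split=> [/h12|/h21].
  by subst J2; congr exist; exact: Prop_irrelevance.
(* The union bounds a nonempty chain; the empty chain is bounded by I. *)
- move=> C tot; have [[J CJ]|nC] := pselect (exists J : T, C J); last first.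
    by exists (exist _ I I0) => J CJ; case: nC; exists J.
  pose U a := exists2 J : T, C J & sval J a.
  have UP : is_ideal U /\ ~ U 1 /\ forall a, I a -> U a.
    split; [split|split].
    + by exists J => //; case: (svalP J) => -[].
    + move=> a b [J1 C1 a1] [J2 C2 b2].
      have [/asboolP h|/asboolP h] := tot _ _ C1 C2.
        by exists J2 => //; apply: idealD (h _ a1) b2; case: (svalP J2).
      by exists J1 => //; apply: idealD a1 (h _ b2); case: (svalP J1).
    + by move=> r a [J1 C1 a1]; exists J1 => //; apply: idealMl a1; case: (svalP J1).
    + by move=> [J1 _]; case: (svalP J1) => _ [].
    + by move=> a Ia; exists J => //; case: (svalP J) => _ [_]; apply.
  by exists (exist _ U UP) => J1 C1; apply/asboolP => a a1; exists J1.
move=> [m [idm [m1 Im]]] mmax; exists m => //; split=> // a na.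
apply: contrapT => nu.
(* J is m + (a); it is proper because 1 in J would invert a modulo m. *)
pose J b := exists r, m (b - r * a).
have JP : is_ideal J /\ ~ J 1 /\ forall b, I b -> J b.
  split; [split|split].
  - by exists 0; rewrite mul0r subr0; exact: ideal0.
  - move=> b c [r mr] [s ms]; exists (r + s).
    by rewrite mulrDl opprD addrACA; exact: idealD.
  - move=> t b [r mr]; exists (t * r).
    by rewrite -mulrA -mulrBr; exact: idealMl.
  - by move=> [r mr]; apply: nu; exists r.
  - by move=> b /Im mb; exists 0; rewrite mul0r subr0.
have mJ b : m b -> J b by move=> mb; exists 0; rewrite mul0r subr0.
have /(congr1 sval) /= E := mmax (exist _ J JP) (introT (asboolP _) mJ).
by apply: na; rewrite -E; exists 1; rewrite mul1r subrr; exact: ideal0.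
Qed.

End Ideals.

(** * Hilbert's basis theorem for subrings *)

Lemma choice_seq (T : eqType) (U : Type) (u0 : U) (s : seq T) (Q : T -> U -> Prop) :
  (forall x, x \in s -> exists y, Q x y) ->
  exists f : T -> U, forall x, x \in s -> Q x (f x).
Proof.
move=> sQ; have [|f fP] := @choice T U (fun x y => x \in s -> Q x y).
  by move=> x; have [/sQ[y]|_] := boolP (x \in s); [exists y|exists u0].
by exists f.
Qed.

Section RelativeNoetherianity.
Variable B : comNzRingType.
Implicit Types (T I : B -> Prop).

Record is_subring T : Prop := IsSubring {
  subring1 : T 1;
  subringB : forall a b, T a -> T b -> T (a - b);
  subringM : forall a b, T a -> T b -> T (a * b) }.

Record is_submod T (V : lmodType B) (J : V -> Prop) : Prop := IsSubmod {
  submod0 : J 0;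
  submodD : forall a b, J a -> J b -> J (a + b);
  submodZ : forall t a, T t -> J a -> J (t *: a) }.

(** Impredicative span: membership is itself the induction principle, and no coefficients have to be
    chosen. *)
Definition gen T (V : lmodType B) (s : seq V) (a : V) :=
  forall J : V -> Prop, is_submod T J -> (forall x, x \in s -> J x) -> J a.

(** Subrings are predicates on one fixed ring B, so that finitely generated subrings, such as the
    Rees algebra in R[t], arise by iterating [adjoin] without new types. *)
Definition noeth T := forall I : B^o -> Prop,
  is_submod T I -> (forall a, I a -> T a) ->
  exists2 s : seq B^o, forall x, x \in s -> I x & forall a, I a -> gen T s a.

Definition poly_over T (p : {poly B}) := forall i, T p`_i.

Definition adjoin T (b x : B) := exists2 p, poly_over T p & x = p.[b].

Lemma gen_submod T (V : lmodType B) (s : seq V) : is_submod T (gen T s).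
Proof.
split=> [J JT _|a b ga gb J JT Js|t a Tt ga J JT Js]; first exact: (submod0 JT).
  by apply: (submodD JT); [exact: ga|exact: gb].
by apply: (submodZ JT) => //; exact: ga.
Qed.

Lemma gen_mem T (V : lmodType B) (s : seq V) a : a \in s -> gen T s a.
Proof. by move=> sa J _; apply. Qed.

Lemma gen_trans T (V : lmodType B) (s s' : seq V) a :
  (forall x, x \in s -> gen T s' x) -> gen T s a -> gen T s' a.
Proof. by move=> ss' ga; apply: ga => //; exact: gen_submod. Qed.

Section Subring.
Variable T : B -> Prop.
Hypothesis ringT : is_subring T.

Lemma subring0 : T 0.
Proof. by rewrite -(subrr 1); apply: subringB => //; exact: subring1. Qed.

Lemma subringN a : T a -> T (- a).
Proof. by rewrite -sub0r; apply: subringB => //; exact: subring0. Qed.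

Lemma subringD a b : T a -> T b -> T (a + b).
Proof. by move=> Ta Tb; rewrite -[b]opprK; apply: subringB => //; exact: subringN. Qed.

Lemma subringX a n : T a -> T (a ^+ n).
Proof.
move=> Ta; elim: n => [|n IH]; first exact: subring1.
by rewrite exprS; exact: subringM.
Qed.

Lemma subring_sum (A : Type) (s : seq A) (Q : pred A) (F : A -> B) :
  (forall i, Q i -> T (F i)) -> T (\sum_(i <- s | Q i) F i).
Proof.
by move=> IF; elim/big_ind: _ => //; [exact: subring0|exact: subringD].
Qed.

Lemma submodB (V : lmodType B) (J : V -> Prop) a b :
  is_submod T J -> J a -> J b -> J (a - b).
Proof.
move=> JT Ja Jb; apply: (submodD JT) => //; rewrite -scaleN1r.
by apply: (submodZ JT) => //; apply: subringN; exact: subring1.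
Qed.

Lemma subring_horner p b : poly_over T p -> T b -> T p.[b].
Proof.
move=> Tp Tb; rewrite horner_coef; apply: subring_sum => i _.
by apply: subringM => //; exact: subringX.
Qed.

Lemma poly_over_subring : is_submod T (poly_over T) /\
  forall p q, poly_over T p -> poly_over T q -> poly_over T (p * q).
Proof.
split; [split=> [i|p q Tp Tq i|t p Tt Tp i]|move=> p q Tp Tq i].
- by rewrite coef0; exact: subring0.
- by rewrite coefD; exact: subringD.
- by rewrite coefZ; exact: subringM.
- by rewrite coefM; apply: subring_sum => j _; exact: subringM.
Qed.

Lemma poly_overC c : T c -> poly_over T c%:P.
Proof. by move=> Tc i; rewrite coefC; case: ifP => // _; exact: subring0. Qed.

Lemma poly_overXn n : poly_over T 'X^n.
Proof.
by move=> i; rewrite coefXn; case: (i == n); [exact: subring1|exact: subring0].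
Qed.

Lemma adjoin_subring b : is_subring (adjoin T b).
Proof.
have [sT mT] := poly_over_subring; split.
- by exists 1%:P; [apply: poly_overC; exact: subring1|rewrite hornerC].
- move=> _ _ [p Tp ->] [q Tq ->]; exists (p - q); last by rewrite hornerD hornerN.
  exact: (submodB sT).
- by move=> _ _ [p Tp ->] [q Tq ->]; exists (p * q); [exact: mT|rewrite hornerM].
Qed.

Lemma adjoin_base b c : T c -> adjoin T b c.
Proof. by move=> Tc; exists c%:P; [exact: poly_overC|rewrite hornerC]. Qed.

Lemma adjoin_gen b : adjoin T b b.
Proof. by exists 'X; [exact: (poly_overXn 1)|rewrite hornerX]. Qed.

Hypothesis noethT : noeth T.

(** Induction on n: the coefficients at X^n of the members of size at most n + 1 form an ideal of T,
    and subtracting lifts of its generators lowers the size. *)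
Lemma noeth_poly_le (J : {poly B} -> Prop) n :
  is_submod T J -> (forall p, J p -> poly_over T p) ->
  exists2 s : seq {poly B}, forall p, p \in s -> J p /\ (size p <= n)%N &
    forall p, J p -> (size p <= n)%N -> gen T s p.
Proof.
move=> JT JP; elim: n => [|n [s sJ sgen]].
  exists [::] => // p _; rewrite leqn0 size_poly_eq0 => /eqP->.
  exact: (submod0 (gen_submod _ _)).
pose L (c : B^o) := exists p, [/\ J p, (size p <= n.+1)%N & p`_n = c].
have LT : is_submod T L.
  split.
  - by exists 0; rewrite coef0 size_poly0; split=> //; exact: (submod0 JT).
  - move=> _ _ [p [Jp sp <-]] [q [Jq sq <-]]; exists (p + q); rewrite coefD; split=> //.
      exact: (submodD JT).
    by rewrite (leq_trans (size_polyD _ _)) // geq_max sp.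
  - move=> t _ Tt [p [Jp sp <-]]; exists (t *: p); rewrite coefZ; split=> //.
      exact: (submodZ JT).
    by rewrite (leq_trans (size_scale_leq _ _)).
have [|cs csL csgen] := noethT LT.
  by move=> _ [p [/JP Tp _ <-]]; exact: Tp.
have [f fP] := choice_seq (0 : {poly B}) csL.
exists ([seq f c | c <- cs] ++ s).
  move=> p; rewrite mem_cat => /orP[/mapP[c /fP[? ? _] ->]|/sJ[? sp]] //.
  by split=> //; exact: leqW.
move=> p Jp sp.
have [q [Jq sq qn gq]] : exists q, [/\ J q, (size q <= n.+1)%N, q`_n = p`_n &
    gen T ([seq f c | c <- cs] ++ s) q].
  apply: (csgen p`_n _ (fun c => exists q, [/\ J q, (size q <= n.+1)%N, q`_n = c &
    gen T ([seq f c | c <- cs] ++ s) q])); first by exists p.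
    split.
    - exists 0; rewrite coef0 size_poly0; split=> //; first exact: (submod0 JT).
      exact: (submod0 (gen_submod _ _)).
    - move=> _ _ [q [Jq sq <- gq]] [r [Jr sr <- gr]]; exists (q + r).
      rewrite coefD; split=> //; first exact: (submodD JT).
        by rewrite (leq_trans (size_polyD _ _)) // geq_max sq.
      exact: (submodD (gen_submod _ _) gq gr).
    - move=> t _ Tt [q [Jq sq <- gq]]; exists (t *: q); rewrite coefZ; split=> //.
      + exact: (submodZ JT).
      + by rewrite (leq_trans (size_scale_leq _ _)).
      + exact: (submodZ (gen_submod _ _) Tt gq).
  move=> c cP; exists (f c); have [? ? ?] := fP _ cP; split=> //.
  by apply: gen_mem; rewrite mem_cat map_f.
rewrite -(subrK q p); apply: (submodD (gen_submod _ _)) => //.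
apply: (gen_trans (s := s)).
  by move=> x xs; apply: gen_mem; rewrite mem_cat xs orbT.
apply: sgen; first exact: (submodB JT).
apply/leq_sizeP => j; rewrite leq_eqVlt => /orP[/eqP<-|nj].
  by rewrite coefB qn subrr.
by rewrite coefB !(leq_sizeP _ _ _ j nj) ?subrr.
Qed.

(** Hilbert's argument, with ideals of T[X] encoded as T-modules stable under ['X]. Leading
    coefficients lower the size down to N; from there on [noeth_poly_le] applies. *)
Lemma noeth_poly (J : {poly B} -> Prop) :
  is_submod T J -> (forall p, J p -> J ('X * p)) ->
  (forall p, J p -> poly_over T p) ->
  exists2 s : seq {poly B}, forall p, p \in s -> J p &
    forall p, J p -> forall J' : {poly B} -> Prop, is_submod T J' ->
      (forall q, J' q -> J' ('X * q)) -> (forall q, q \in s -> J' q) -> J' p.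
Proof.
move=> JT JX JP.
have JXn (J' : {poly B} -> Prop) k p : (forall q, J' q -> J' ('X * q)) ->
    J' p -> J' ('X^k * p).
  by move=> J'X J'p; elim: k => [|k IH]; rewrite ?mul1r // exprS -mulrA; exact: J'X.
have sXn k (p : {poly B}) n : (size p <= n.+1)%N ->
    (size ('X^k * p)%R <= (k + n).+1)%N /\ ('X^k * p)`_(k + n) = p`_n.
  move=> sp; rewrite (leq_trans (size_polyMleq _ _)) ?size_polyXn /=; last first.
    by rewrite -addnS leq_add2l.
  by rewrite coefXnM ltnNge leq_addr /= addKn.
(* The size is only bounded, so c may be 0; this makes L closed under addition. *)
pose L (c : B^o) := exists p n, [/\ J p, (size p <= n.+1)%N & p`_n = c].
have LT : is_submod T L.
  split.
  - by exists 0, 0%N; rewrite coef0 size_poly0; split=> //; exact: (submod0 JT).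
  - move=> _ _ [p [n [Jp sp <-]]] [q [k [Jq sq <-]]].
    have [sp' <-] := sXn k p n sp; have [sq' <-] := sXn n q k sq.
    exists ('X^k * p + 'X^n * q), (n + k)%N; rewrite coefD (addnC n k); split=> //.
      by apply: (submodD JT); exact: JXn.
    by rewrite (leq_trans (size_polyD _ _)) // geq_max sp' addnC sq'.
  - move=> t _ Tt [p [n [Jp sp <-]]]; exists (t *: p), n; rewrite coefZ; split=> //.
      exact: (submodZ JT).
    by rewrite (leq_trans (size_scale_leq _ _)).
have [|cs csL csgen] := noethT LT.
  by move=> _ [p [n [/JP Tp _ <-]]]; exact: Tp.
have [|f fP] := choice_seq (0 : {poly B}, 0%N) (s := cs) (Q := fun c pn =>
    [/\ J pn.1, (size pn.1 <= pn.2.+1)%N & pn.1`_pn.2 = c]).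
  by move=> c /csL[p [n pP]]; exists (p, n).
pose N := \max_(c <- cs) (f c).2.
have fN c : c \in cs -> ((f c).2 <= N)%N.
  by move=> cs_c; rewrite /N (big_rem c) //= leq_maxl.
have [s sJ sgen] := noeth_poly_le N JT JP.
exists ([seq (f c).1 | c <- cs] ++ s).
  by move=> p; rewrite mem_cat => /orP[/mapP[c /fP[? _ _] ->]|/sJ[]].
move=> p Jp J' J'T J'X J's.
have [n] := ubnP (size p); elim: n p Jp => // n IH p Jp; rewrite ltnS => sp.
have [spN|Nsp] := leqP (size p) N.
  by apply: (sgen p) => // q qs; apply: J's; rewrite mem_cat qs orbT.
case: n IH sp => [|n] IH sp; first by move: Nsp; rewrite ltnNge (leq_trans sp).
have Nn : (N <= n)%N by rewrite -ltnS (leq_trans Nsp).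
have [q [Jq J'q sq qn]] : exists q, [/\ J q, J' q, (size q <= n.+1)%N & q`_n = p`_n].
  apply: (csgen p`_n _ (fun c => exists q, [/\ J q, J' q, (size q <= n.+1)%N & q`_n = c])).
  - by exists p, n.
  - split.
    + exists 0; rewrite coef0 size_poly0; split=> //.
        exact: (submod0 JT).
      exact: (submod0 J'T).
    + move=> _ _ [q [Jq J'q sq <-]] [r [Jr J'r sr <-]]; exists (q + r).
      rewrite coefD; split=> //; [exact: (submodD JT)|exact: (submodD J'T)|].
      by rewrite (leq_trans (size_polyD _ _)) // geq_max sq.
    + move=> t _ Tt [q [Jq J'q sq <-]]; exists (t *: q); rewrite coefZ; split=> //.
      * exact: (submodZ JT).
      * exact: (submodZ J'T).
      * by rewrite (leq_trans (size_scale_leq _ _)).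
  move=> c cP; have [Jf sf fc] := fP _ cP.
  exists ('X^(n - (f c).2) * (f c).1).
  have [] := sXn (n - (f c).2)%N _ _ sf; rewrite subnK ?(leq_trans (fN _ cP)) // => sq qn.
  split=> //; [exact: JXn| |by rewrite qn].
  by apply: JXn => //; apply: J's; rewrite mem_cat; apply/orP; left; apply/mapP; exists c.
rewrite -(subrK q p); apply: (submodD J'T) => //; apply: IH.
  exact: (submodB JT).
rewrite ltnS; apply/leq_sizeP => j; rewrite leq_eqVlt => /orP[/eqP<-|nj].
  by rewrite coefB qn subrr.
by rewrite coefB !(leq_sizeP _ _ _ j nj) ?subrr.
Qed.

(** T[b] is the image of T[X] under evaluation, so ideals are pulled back to polynomials. *)
Lemma noeth_adjoin b : noeth (adjoin T b).
Proof.
have ringA := adjoin_subring b; have [sT mT] := poly_over_subring.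
move=> I IT IA.
have [||| s sJ sgen] := @noeth_poly (fun p => poly_over T p /\ I p.[b]).
- split.
  + by split; [exact: (submod0 sT)|rewrite horner0; exact: (submod0 IT)].
  + move=> p q [Tp Ip] [Tq Iq]; split; first exact: (submodD sT).
    by rewrite hornerD; exact: (submodD IT).
  + move=> t p Tt [Tp Ip]; split; first exact: (submodZ sT).
    by rewrite hornerZ; apply: (submodZ IT) => //; exact: adjoin_base.
- move=> p [Tp Ip]; split; first by apply: mT => //; exact: (poly_overXn 1).
  by rewrite hornerM hornerX; apply: (submodZ IT) => //; exact: adjoin_gen.
- by move=> p [].
exists [seq p.[b] : B^o | p <- s]; first by move=> _ /mapP[p /sJ[_ ?] ->].
move=> a Ia J' J'T J's; have [p Tp ap] := IA _ Ia.
suff [] : poly_over T p /\ J' p.[b] by rewrite ap.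
apply: (sgen p _ (fun q => poly_over T q /\ J' q.[b])).
- by rewrite -ap.
- split.
  + by split; [exact: (submod0 sT)|rewrite horner0; exact: (submod0 J'T)].
  + move=> q r [Tq Jq] [Tr Jr]; split; first exact: (submodD sT).
    by rewrite hornerD; exact: (submodD J'T).
  + move=> t q Tt [Tq Jq]; split; first exact: (submodZ sT).
    by rewrite hornerZ; apply: (submodZ J'T) => //; exact: adjoin_base.
- move=> q [Tq Jq]; split; first by apply: mT => //; exact: (poly_overXn 1).
  by rewrite hornerM hornerX; apply: (submodZ J'T) => //; exact: adjoin_gen.
- by move=> q qs; split; [case: (sJ q qs)|apply: J's; exact: map_f].
Qed.

End Subring.

Lemma adjoin_min T T' b : is_subring T' ->
  (forall c, T c -> T' c) -> T' b -> forall x, adjoin T b x -> T' x.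
Proof.
move=> ringT' TT' Tb _ [p Tp ->].
by apply: (subring_horner ringT') => // i; exact: TT'.
Qed.

End RelativeNoetherianity.

(** * The Artin-Rees lemma *)

Section ArtinRees.
Variable R : comNzRingType.
Implicit Types (I J P m : R -> Prop).

Definition bool_ideal I : pred R := fun a => `[< I a >].

Lemma idealr_of I : is_ideal I -> ~ I 1 ->
  exists J : idealr R, forall a, a \in J <-> I a.
Proof.
move=> idI I1; have cl : idealr_closed (bool_ideal I).
  split; first by apply/asboolP; exact: ideal0.
    by apply/asboolP.
  move=> a u v /asboolP Iu /asboolP Iv; apply/asboolP.
  by apply: idealD => //; exact: idealMl.
pose J : idealr R := HB.pack (bool_ideal I) (isIdealr.Build R (bool_ideal I) cl).
by exists J => a; split=> [/asboolP|Ia]; last apply/asboolP.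
Qed.

Hypothesis noethR : noetherian R.

Lemma noetherian_fg I : is_ideal I ->
  exists n (x : 'I_n -> R), (forall i, I (x i)) /\
    forall a, I a -> exists c : 'I_n -> R, a = \sum_i c i * x i.
Proof.
move=> idI; have [I1|I1] := pselect (I 1).
  exists 1%N, (fun=> 1); split=> // a _; exists (fun=> a).
  by rewrite big_ord1 mulr1.
have [J JI] := idealr_of idI I1; have [n [x xP]] := noethR J.
exists n, x; split=> [i|a /JI/xP//].
apply/JI/xP; exists (fun j => (j == i)%:R).
by rewrite (bigD1 i) //= eqxx mul1r big1 ?addr0 // => j /negPf->; rewrite mul0r.
Qed.

(** The algebra R[z_1 t, ..., z_n t] in R[t]. If the z_i generate m, it consists of the polynomials
    whose coefficient at t^i lies in m^i, by [rees_coef] and [rees_monomial]. *)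
Definition rees (zs : seq R) : {poly R} -> Prop :=
  foldr (fun z T => adjoin T (z *: 'X)) (fun p => exists r, p = r%:P) zs.

Lemma rees_subring zs : is_subring (rees zs).
Proof.
elim: zs => [|z zs IH]; last exact: adjoin_subring.
split; first by exists 1.
  by move=> _ _ [r ->] [s ->]; exists (r - s); rewrite polyCB.
by move=> _ _ [r ->] [s ->]; exists (r * s); rewrite polyCM.
Qed.

Lemma noeth_rees zs : noeth (rees zs).
Proof.
elim: zs => [|z zs IH]; last by apply: noeth_adjoin => //; exact: rees_subring.
move=> I IT IC; have idI : is_ideal (fun r => I r%:P).
  split; first exact: (submod0 IT).
    by move=> a b Ia Ib; rewrite polyCD; exact: (submodD IT).
  by move=> r a Ia; rewrite polyCM; apply: (submodZ IT) => //; exists r.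
have [n [x [xI xgen]]] := noetherian_fg idI.
exists [seq (x i)%:P : {poly R}^o | i <- enum 'I_n].
  by move=> _ /mapP[i _ ->].
move=> p Ip J JT Jx; have [r pr] := IC p Ip; subst p.
have [c ->] := xgen r Ip; rewrite rmorph_sum.
elim/big_ind: _ => [|a b Ja Jb|i _]; first exact: (submod0 JT).
  exact: (submodD JT).
suff : J ((c i)%:P * (x i)%:P) by rewrite -polyCM.
apply: (submodZ JT); first by exists (c i).
by apply: Jx; apply/mapP; exists i => //; rewrite mem_enum.
Qed.

Lemma rees_const zs r : rees zs r%:P.
Proof.
elim: zs => [|z zs IH]; first by exists r.
by apply: adjoin_base IH; exact: rees_subring.
Qed.

Lemma rees_gen zs z : z \in zs -> rees zs (z *: 'X).
Proof.
elim: zs => // y zs IH; rewrite inE => /orP[/eqP->|/IH].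
  by apply: adjoin_gen; exact: rees_subring.
by apply: adjoin_base; exact: rees_subring.
Qed.

Section ReesIdeal.
Variables (m : R -> Prop) (zs : seq R).
Hypothesis idm : is_ideal m.
Hypothesis zsm : forall z, z \in zs -> m z.
Hypothesis zsgen : forall J, is_ideal J -> (forall z, z \in zs -> J z) ->
  forall a, m a -> J a.

Lemma rees_coef p i : rees zs p -> ideal_exp m i p`_i.
Proof.
have idE := @ideal_exp_ideal _ _ _ idm.
have ringU : is_subring (fun p : {poly R} => forall i, ideal_exp m i p`_i).
  split=> [j|q r mq mr j|q r mq mr j].
  - by rewrite coef1; case: j => [|j]; [|exact: ideal0].
  - by rewrite coefB; exact: idealB.
  - rewrite coefM; apply: ideal_sum => // k _.
    by rewrite -{1}(subnKC (leq_ord k)); exact: ideal_exp_mul.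
move=> rp; move: i; elim: zs zsm p rp => [|z s IH] sm p.
  by move=> [r ->] i; rewrite coefC; case: i => [|i]; [|exact: ideal0].
apply: (adjoin_min ringU).
  by apply: IH => x xs; apply: sm; rewrite inE xs orbT.
move=> i; rewrite coefZ coefX; case: eqP => [->|_]; last by rewrite mulr0; exact: ideal0.
by rewrite mulr1; apply/ideal_exp1 => //; apply: sm; rewrite mem_head.
Qed.

Lemma rees_monomial i a : ideal_exp m i a -> rees zs (a *: 'X^i).
Proof.
have rS := rees_subring zs; elim: i a => [|i IH] a.
  by move=> _; rewrite alg_polyC; exact: rees_const.
move=> [s [sP ->]]; rewrite scaler_suml big_seq.
apply: subring_sum => // c /sP[mc /IH ec].
suff E b : m b -> rees zs (b *: 'X).
  rewrite exprS -scalerA scalerAr scalerAl; apply: subringM => //; exact: E.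
apply: (zsgen (J := fun b => rees zs (b *: 'X))); last exact: rees_gen.
split; first by rewrite scale0r; exact: subring0.
- by move=> x y rx ry; rewrite scalerDl; exact: subringD.
- move=> r x rx; rewrite -scalerA -mul_polyC; apply: subringM => //.
  exact: rees_const.
Qed.

End ReesIdeal.

(** The members of the Rees algebra with all coefficients in P + R x form a finitely generated ideal
    E, and a bounds the size of its generators. Primality of P finally cancels x. *)
Lemma artin_rees m P x : is_ideal m -> is_prime P -> ~ P x ->
  exists a, forall N r, ideal_add P (ideal_exp m N) (r * x) ->
    ideal_add P (ideal_exp m (N - a)) r.
Proof.
move=> idm [idP P1 PM] Px; have [n [z [zm zgen]]] := noetherian_fg idm.
pose zs := [seq z i | i <- enum 'I_n].
have zsm b : b \in zs -> m b by move=> /mapP[i _ ->].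
have zsgen J : is_ideal J -> (forall b, b \in zs -> J b) -> forall a, m a -> J a.
  move=> idJ Jz a /zgen[c ->]; apply: ideal_sum => // i _; apply: idealMl => //.
  by apply: Jz; apply: map_f; rewrite mem_enum.
have rS := rees_subring zs; have idE := @ideal_exp_ideal _ _ _ idm.
pose E (p : {poly R}^o) := rees zs p /\ forall i, exists r, P (p`_i - r * x).
have [|p []//|s sE sgen] := @noeth_rees zs E.
  split.
  - split=> [|i]; first exact: subring0.
    by exists 0; rewrite coef0 mul0r subr0; exact: ideal0.
  - move=> p q [rp Ep] [rq Eq]; split=> [|i]; first exact: subringD.
    have [[u Pu] [v Pv]] := (Ep i, Eq i); exists (u + v).
    by rewrite coefD mulrDl opprD addrACA; exact: idealD.
  - move=> t p rt [rp Ep]; split=> [|i]; first exact: subringM.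
    have [f fP] := choice Ep.
    exists (\sum_(j < i.+1) t`_j * f (i - j)%N).
    rewrite [t *: p]/(t * p) coefM mulr_suml -sumrB; apply: ideal_sum => // j _.
    by rewrite -mulrA -mulrBr; exact: idealMl.
pose a := \max_(p <- s) size (p : {poly R}).
exists a => N r [p0 Pp0 mw]; set w := r * x - p0 in mw.
have Ew : E (w *: 'X^N).
  split; first exact: (rees_monomial zsgen).
  move=> i; rewrite coefZ coefXn; case: (i == N); last first.
    by exists 0; rewrite mulr0 mul0r subr0; exact: ideal0.
  by exists r; rewrite mulr1 /w addrAC subrr sub0r; exact: idealN.
(* Q is stable under the Rees algebra, where the coefficient at t^j lies in m^j. It holds for the
   generators: their coefficients vanish from index a on, and below a the truncated exponent i - a
   is 0. *)
pose Q (p : {poly R}^o) := forall i, exists2 u, ideal_exp m (i - a) u & P (p`_i - u * x).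
have /(_ N) [u mu] : Q (w *: 'X^N).
  apply: (sgen _ Ew).
    split.
    - by move=> i; exists 0; [exact: ideal0|rewrite coef0 mul0r subr0; exact: ideal0].
    - move=> p q Qp Qq i; have [[u mu Pu] [v mv Pv]] := (Qp i, Qq i).
      exists (u + v); first exact: idealD.
      by rewrite coefD mulrDl opprD addrACA; exact: idealD.
    - move=> t p rt Qp i.
      have [|f fP] := @choice nat R (fun i u => ideal_exp m (i - a) u /\ P (p`_i - u * x)).
        by move=> j; have [u mu Pu] := Qp j; exists u.
      exists (\sum_(j < i.+1) t`_j * f (i - j)%N).
        apply: ideal_sum => // j _.
        apply: (ideal_exp_le (n := (j + (i - j - a))%N)) => //.
          by rewrite -leq_subLR subnAC.
        by apply: ideal_exp_mul => //; [exact: (rees_coef idm zsm)|case: (fP (i - j)%N)].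
      rewrite [t *: p]/(t * p) coefM mulr_suml -sumrB; apply: ideal_sum => // j _.
      by rewrite -mulrA -mulrBr; apply: idealMl => //; case: (fP (i - j)%N).
  move=> p ps i; have [rp Ep] := sE _ ps; have [ai|ia] := leqP a i.
    exists 0; first exact: ideal0.
    rewrite mul0r subr0 nth_default; first exact: ideal0.
    by apply: leq_trans ai; rewrite /a (big_rem p) //= leq_maxl.
  have [u Pu] := Ep i; exists u => //.
  by move: (ltnW ia); rewrite -subn_eq0 => /eqP->.
rewrite coefZ coefXn eqxx mulr1 => Pu.
exists (r - u); last by rewrite subKr.
have [|//|//] := PM (r - u) x; rewrite mulrBl.
by rewrite (_ : _ - _ = (w - u * x) + p0); [exact: idealD|rewrite /w; ring].
Qed.

End ArtinRees.

(** Artin-Rees for P = 0 and x = f: if f = 1 * f were in m^(a+1), then 1 would be in m. *)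
Lemma krull_intersection (R : idomainType) (m : R -> Prop) (f : R) :
  noetherian R -> is_ideal m -> ~ m 1 -> f != 0 -> exists n, ~ ideal_exp m n f.
Proof.
move=> noethR idm m1 f0.
have P0 : is_prime (fun a : R => a = 0).
  split; [split=> [//|a b -> ->|r a ->]|by apply/eqP/oner_neq0|].
  - by rewrite addr0.
  - by rewrite mulr0.
  - by move=> a b /eqP; rewrite mulf_eq0 => /orP[]/eqP; [left|right].
have [|a aP] := artin_rees noethR idm P0 (x := f); first exact/eqP.
exists a.+1 => mf; have [|_ ->] := aP a.+1 1.
  by exists 0; rewrite // mul1r subr0.
by rewrite subSnn subr0 => /(ideal_exp1 _ idm).
Qed.

(** * Zariski's lemma *)

Lemma quotient_exists (R : comNzRingType) (I : R -> Prop) : is_ideal I -> ~ I 1 ->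
  exists (L : comNzRingType) (pi : {rmorphism R -> L}),
    (forall x, exists a, pi a = x) /\ forall a, pi a = 0 <-> I a.
Proof.
move=> idI I1; have [J JI] := idealr_of idI I1.
pose pi : R -> {ideal_quot J} := \pi_({ideal_quot J})%qT.
exists {ideal_quot J}, (GRing.RMorphism.clone _ _ pi _); split=> [x|a] /=.
  by exists (repr x); exact: reprK.
have E : (pi a == pi 0) = (a \in J) by rewrite -[a in a \in J]subr0 Quotient.idealrBE.
have pi0 : pi 0 = 0 by exact: (rmorph0 \pi_({ideal_quot J})%qT).
by rewrite -JI -E pi0; split=> [->|/eqP].
Qed.

Section Zariski.

Definition ring_gen (A L : comNzRingType) (j : A -> L) (ys : seq L) :=
  forall S : L -> Prop, is_subring S -> (forall a, S (j a)) ->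
    (forall y, y \in ys -> S y) -> forall x, S x.

Definition alg_over (A L : nzRingType) (j : A -> L) (y : L) :=
  exists2 p : {poly A}, p != 0 & (map_poly j p).[y] = 0.

(** For p of degree n + 1 with leading coefficient a, a^n p(y) is a monic polynomial in a y whose
    lower coefficients are p_i a^(n-i). *)
Lemma integral_lead (A : idomainType) (L : comNzRingType) (j : {rmorphism A -> L}) y :
  (forall a, j a = 0 -> a = 0) -> alg_over j y ->
  exists2 a, a != 0 & integralOver j (j a * y).
Proof.
move=> injj [p p0 py]; set a := lead_coef p; have a0 : a != 0 by rewrite lead_coef_eq0.
exists a => //; have [n sp] : exists n, size p = n.+1.
  by exists (size p).-1; rewrite -polySpred.
case: n sp => [|n] sp.
  case/eqP: p0; move/eqP: sp => /size_poly1P[c c0 pc]; move: py.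
  by rewrite pc map_polyC hornerC /= => /injj->.
pose q := 'X^(n.+1) + \poly_(i < n.+1) (p`_i * a ^+ (n - i)).
have sq : (size (\poly_(i < n.+1) (p`_i * a ^+ (n - i)))%R <
    size ('X^(n.+1) : {poly A})%R)%N.
  by rewrite size_polyXn ltnS size_poly.
have mq : q \is monic by rewrite monicE lead_coefDl // lead_coefXn.
exists q => //; rewrite /root; apply/eqP.
have E : (map_poly j q).[j a * y] = j a ^+ n * (map_poly j p).[y].
  rewrite rmorphD /= map_polyXn hornerD hornerXn.
  rewrite [in RHS]horner_coef size_map_poly_id0 ?rmorph_eq0; last first.
    by apply: contra_neq a0 => /injj.
  rewrite sp big_ord_recr /= mulrDr addrC !coef_map /=; congr (_ + _).
    rewrite (@horner_coef_wide _ n.+1); last first.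
      by rewrite (leq_trans (size_poly _ _)) // size_poly.
    rewrite mulr_sumr; apply: eq_bigr => i _.
    rewrite coef_map coef_poly ltn_ord /= rmorphM rmorphXn exprMn coef_map /=.
    have -> : j a ^+ n = j a ^+ (n - i) * j a ^+ i.
      by rewrite -exprD subnK // -ltnS.
    by ring.
  have -> : p`_n.+1 = a by rewrite /a lead_coefE sp.
  by rewrite exprMn exprS; ring.
by rewrite E py mulr0.
Qed.

(** s is a product of leading coefficients, one for each generator. The x that become integral after
    multiplication by some power of s form a subring. *)
Lemma almost_integral (A : idomainType) (L : comNzRingType) (j : {rmorphism A -> L})
    (ys : seq L) : (forall a, j a = 0 -> a = 0) ->
  (forall y, y \in ys -> alg_over j y) -> ring_gen j ys ->
  exists2 s, s != 0 & forall x, exists N, integralOver j (j s ^+ N * x).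
Proof.
move=> injj algy gen.
have [s s0 sP] : exists2 s, s != 0 & forall y, y \in ys -> integralOver j (j s * y).
  elim: ys algy {gen} => [|y ys IH] algy; first by exists 1; rewrite ?oner_eq0.
  have [|s s0 sP] := IH; first by move=> z zs; apply: algy; rewrite inE zs orbT.
  have [a a0 ay] := integral_lead injj (algy y (mem_head _ _)).
  exists (a * s); first by rewrite mulf_neq0.
  move=> z; rewrite inE rmorphM => /orP[/eqP->|/sP iz].
    by rewrite mulrAC; apply: integral_mul => //; exact: integral_id.
  by rewrite -mulrA; apply: integral_mul => //; exact: integral_id.
exists s => //.
have up N k x : integralOver j (j s ^+ N * x) -> integralOver j (j s ^+ (k + N) * x).
  move=> ix; rewrite exprD -mulrA; apply: integral_mul => //; rewrite -rmorphXn.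
  exact: integral_id.
apply: gen.
- split; first by exists 0%N; rewrite mulr1; exact: integral1.
  + move=> x y [N Nx] [k ky]; exists (k + N)%N; rewrite mulrBr.
    by apply: integral_sub; [exact: up|rewrite addnC; exact: up].
  + move=> x y [N Nx] [k ky]; exists (N + k)%N.
    by rewrite exprD mulrACA; exact: integral_mul.
- by move=> a; exists 0%N; rewrite mul1r; exact: integral_id.
- by move=> y /sP iy; exists 1%N.
Qed.

Lemma size_1addXM (A : idomainType) (s : {poly A}) :
  s != 0 -> size (1 + 'X * s)%R = (size s).+1.
Proof.
move=> s0; have sX : size ('X * s) = (size s).+1 by rewrite mulrC size_mulX.
by rewrite addrC size_polyDl sX // size_poly1 ltnS size_poly_gt0.
Qed.

(** Put v = 1 + X s and let n be the degree of an integral equation for s^N / v. Multiplying it by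
    v^n shows that v divides s^(N n). As X s = -1 modulo v, v would divide 1, but v has positive
    degree. *)
Lemma not_almost_integral (A : idomainType) (L : comNzRingType)
    (j : {rmorphism {poly A} -> L}) (s : {poly A}) x N :
  (forall p, j p = 0 -> p = 0) -> s != 0 -> j (1 + 'X * s) * x = 1 ->
  ~ integralOver j (j s ^+ N * x).
Proof.
move=> injj s0 vx [P mP]; set v := 1 + 'X * s in vx *.
have sv : (1 < size v)%N by rewrite size_1addXM // ltnS size_poly_gt0.
pose I (p : {poly A}) := exists q, p = v * q.
have idI : is_ideal I.
  split; first by exists 0; rewrite mulr0.
    by move=> _ _ [p ->] [q ->]; exists (p + q); rewrite mulrDr.
  by move=> r _ [p ->]; exists (r * p); rewrite mulrCA.
have Iv : I v by exists 1; rewrite mulr1.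
move=> /eqP Px; have nP : size P = (size P).-1.+1 by rewrite -polySpred ?monic_neq0.
set n := (size P).-1 in nP.
have Is : I (s ^+ (N * n)).
  have : \sum_(i < n.+1) P`_i * s ^+ (N * i) * v ^+ (n - i) = 0.
    apply: injj; rewrite rmorph_sum /=.
    transitivity (j v ^+ n * (map_poly j P).[j s ^+ N * x]); last by rewrite Px mulr0.
    rewrite (@horner_coef_wide _ n.+1); last by rewrite -nP size_poly.
    rewrite mulr_sumr.
    apply: eq_bigr => i _; rewrite coef_map !rmorphM !rmorphXn /= exprM exprMn.
    have -> : j v ^+ n = j v ^+ (n - i) * j v ^+ i.
      by rewrite -exprD subnK // -ltnS.
    have E : j v ^+ i * x ^+ i = 1 by rewrite -exprMn vx expr1n.
    transitivity (j P`_i * (j s ^+ N) ^+ i * j v ^+ (n - i) * (j v ^+ i * x ^+ i)).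
      by rewrite E mulr1.
    by ring.
  rewrite big_ord_recr /= subnn mulr1 -[P`_n]/(P`_(size P).-1) -lead_coefE (monicP mP).
  rewrite mul1r addrC => /eqP; rewrite addr_eq0 => /eqP->; apply: idealN => //.
  apply: ideal_sum => // i _; apply: idealMl => //.
  by rewrite -(@prednK (n - i)) ?subn_gt0 // exprS; exact: ideal_Mr.
have [q] : I 1.
  apply: (ideal_congr idI (b := (- ('X * s)) ^+ (N * n))).
    rewrite -opprB; apply: idealN => //; rewrite subrX1; apply: ideal_Mr => //.
    by rewrite -opprD addrC; exact: idealN.
  by rewrite exprNn exprMn; apply: idealMl => //; exact: idealMl.
move=> E; have /eqP := congr1 (fun p : {poly A} => size p) E.
have v0 : v != 0 by rewrite -size_poly_gt0 (leq_trans _ sv).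
have q0 : q != 0 by apply: contra_eq_neq E => ->; rewrite mulr0 oner_eq0.
rewrite size_poly1 size_mul // => /eqP E1.
move: sv E1; have := size_poly_gt0 q; rewrite q0.
by case: (size v) => [|[|k]] //; case: (size q) => [|l] // _ _; rewrite addnS !addSn.
Qed.

(* If [y] were transcendental over [A], then [L] would be algebraic over the
   polynomial ring [A[y]] by induction, hence integral over [A[y]][1/s] for some
   [s]; but the inverse of [1 + y s] is not. *)
Lemma zariski_alg n (A : idomainType) (L : comNzRingType) (j : {rmorphism A -> L})
    (ys : seq L) : size ys = n ->
  (forall x : L, x != 0 -> exists y, x * y = 1) ->
  (forall a, j a = 0 -> a = 0) -> ring_gen j ys ->
  forall y, y \in ys -> alg_over j y.
Proof.
elim: n A j ys => [|n IH] A j ys sz inv injj gen y yys.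
  by move/size0nil: sz yys => ->.
apply: contrapT => nalg.
have trans p : (map_poly j p).[y] = 0 -> p = 0.
  by move=> py; apply: contrapT => /eqP p0; apply: nalg; exists p.
have cjy : commr_rmorph j y by move=> a; exact: mulrC.
pose j' : {rmorphism {poly A} -> L} := horner_morph cjy.
have injj' p : j' p = 0 -> p = 0 by exact: trans.
have gen' : ring_gen j' (rem y ys).
  move=> S ringS Sj Sy; apply: gen => // [a|z zys].
    by rewrite -(horner_morphC cjy); exact: (Sj a%:P).
  have [->|zy] := eqVneq z y; first by rewrite -(horner_morphX cjy); exact: Sj 'X.
  by apply: Sy; move: zys; rewrite (perm_mem (perm_to_rem yys)) inE (negPf zy).
have alg' : forall z, z \in rem y ys -> alg_over j' z.
  by apply: IH => //; rewrite size_rem // sz.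
have [s s0 sP] := almost_integral injj' alg' gen'.
have v0 : j' (1 + 'X * s) != 0.
  apply/eqP => /injj' /(congr1 (fun p : {poly A} => size p)) /eqP.
  by rewrite size_1addXM // size_poly0.
have [x vx] := inv _ v0; have [N] := sP x.
exact: not_almost_integral vx.
Qed.

End Zariski.

(** * Finiteness of the residue field over K *)

Section FieldQuotient.
Variables (K : fieldType) (L : comNzRingType) (j : {rmorphism K -> L}) (ys : seq L).
Hypotheses (alg : forall y, y \in ys -> alg_over j y) (gen : ring_gen j ys).

Lemma field_rmorph_inj (a : K) : j a = 0 -> a = 0.
Proof.
move=> ja; apply/eqP; apply: contraT => a0; have /eqP := oner_neq0 L.
by case; rewrite -(rmorph1 j) -(mulVf a0) rmorphM ja mulr0.
Qed.

Lemma alg_integral y : alg_over j y -> integralOver j y.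
Proof.
move=> /(integral_lead field_rmorph_inj)[a a0 ay].
rewrite -[y]mul1r -(rmorph1 j) -(mulVf a0) rmorphM -mulrA.
by apply: integral_mul => //; exact: integral_id.
Qed.

Lemma all_algebraic x : alg_over j x.
Proof.
have [p mp /eqP px] : integralOver j x; last by exists p => //; exact: monic_neq0.
apply: gen => [|a|y /alg/alg_integral//]; last exact: integral_id.
by split; [exact: integral1|exact: integral_sub|exact: integral_mul].
Qed.

Let closed (J : L -> Prop) := [/\ J 0, forall a b, J a -> J b -> J (a + b) &
  forall k a, J a -> J (j k * a)].
Let span (s : seq L) a := forall J, closed J -> (forall b, b \in s -> J b) -> J a.

Let span_closed s : closed (span s).
Proof.
split=> [J [] //|a b sa sb J Jc Js|k a sa J Jc Js].
  by case: (Jc) => _ JD _; apply: JD; [exact: sa|exact: sb].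
by case: (Jc) => _ _ JZ; apply: JZ; exact: sa.
Qed.

Let span_mem s a : a \in s -> span s a. Proof. by move=> sa J _; apply. Qed.

Let span_mul s s' x : (forall b, b \in s -> span s' (x * b)) ->
  forall a, span s a -> span s' (x * a).
Proof.
move=> sx a sa; have [s0 sD sZ] := span_closed s'.
apply: (sa (fun b => span s' (x * b))) => //; split; first by rewrite mulr0.
  by move=> b c sb sc; rewrite mulrDr; exact: sD.
by move=> k b sb; rewrite mulrCA; exact: sZ.
Qed.

(** Products of bounded powers of the generators span a space that contains 1 and is stable under
    every generator, hence under all of L; since x = x * 1, it is L. *)
Lemma field_quotient_finite :
  exists n (b : 'I_n -> L), forall x, exists c : 'I_n -> K, x = \sum_i j (c i) * b i.
Proof.
have [s s1 sy] : exists2 s, 1 \in s & forall y, y \in ys ->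
    forall b, b \in s -> span s (y * b).
  elim: ys alg => [|y zs IH] algy; first by exists [:: 1]; rewrite ?mem_head.
  have [|s s1 sz] := IH; first by move=> z zsz; apply: algy; rewrite inE zsz orbT.
  have [q mq /eqP qy] := alg_integral (algy _ (mem_head _ _)).
  (* A monic q of degree 0 would be 1 and not vanish at y. So q has degree n + 1, and the powers of
     y up to y^n suffice. *)
  have [n sq] : exists n, size q = n.+2.
    case sq: (size q) => [|[|n]]; last by exists n.
      by move/eqP: sq (monic_neq0 mq); rewrite size_poly_eq0 => ->.
    move: qy (mq); rewrite (size1_polyC (eq_leq sq)) map_polyC hornerC /=.
    by move/field_rmorph_inj->; rewrite monicE lead_coefC eq_sym oner_eq0.
  pose t := [seq y ^+ i * b | i <- iota 0 n.+1, b <- s].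
  have tP i b : (i < n.+1)%N -> b \in s -> y ^+ i * b \in t.
    by move=> ni sb; apply/allpairsP; exists (i, b); rewrite mem_iota.
  have [t0 tD tZ] := span_closed t.
  exists t; first by rewrite -[1]mulr1 -{1}(expr0 y) tP.
  have tX i b : (i < n.+1)%N -> span s b -> span t (y ^+ i * b).
    by move=> ni; apply: span_mul => c sc; apply: span_mem; exact: tP.
  move=> z; rewrite inE => /orP[/eqP->|zsz] _ /allpairsP[[i b] [+ sb ->]];
    rewrite mem_iota add0n => /= ni; last first.
    by rewrite mulrCA; apply: tX => //; exact: sz.
  rewrite mulrA -exprS; have [ni'|] := ltnP i.+1 n.+1.
    by apply: span_mem; exact: tP.
  rewrite ltnS => ni''; have -> : i = n by apply/eqP; rewrite eqn_leq -ltnS ni.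
  have -> : y ^+ n.+1 = - \sum_(k < n.+1) j q`_k * y ^+ k.
    apply/eqP; rewrite -subr_eq0 opprK; apply/eqP; 
    rewrite -[RHS]qy (@horner_coef_wide _ n.+2); last first.
      by rewrite -sq size_poly.
    rewrite [RHS]big_ord_recr /= coef_map /= -[q`_n.+1]/(q`_(n.+2.-1)) -sq -lead_coefE.
    rewrite (monicP mq) rmorph1 mul1r addrC; congr (_ + _).
    by apply: eq_bigr => k _; rewrite coef_map.
  rewrite mulNr mulr_suml -mulN1r -(rmorphN1 j); apply: (tZ).
  apply: (big_ind (span t)) => // k _; rewrite -mulrA; apply: (tZ).
  by apply: span_mem; exact: tP.
have sall x a : span s a -> span s (x * a).
  move: x a; apply: (gen (S := fun x => forall a, span s a -> span s (x * a))).
  - have [s0 sD sZ] := span_closed s; split=> [a|x y xs ys' a sa|x y xs ys' a sa].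
    + by rewrite mul1r.
    + rewrite mulrBl -[- (y * a)]mulN1r -(rmorphN1 j); apply: sD; first exact: xs.
      by apply: sZ; exact: ys'.
    + by rewrite -mulrA; apply: (xs); exact: ys'.
  - by move=> k a; have [_ _ sZ] := span_closed s; exact: sZ.
  - by move=> y /sy; exact: span_mul.
exists (size s), (fun i : 'I_(size s) => s`_i) => x; rewrite -[x]mulr1.
apply: (sall x 1 (span_mem s1) (fun a => exists c : 'I_(size s) -> K,
  a = \sum_i j (c i) * s`_i)).
  split; first by exists (fun=> 0); rewrite big1 // => i _; rewrite rmorph0 mul0r.
    move=> _ _ [c ->] [d ->]; exists (fun i => c i + d i); rewrite -big_split.
    by apply: eq_bigr => i _; rewrite rmorphD mulrDl.
  move=> k _ [c ->]; exists (fun i => k * c i); rewrite mulr_sumr.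
  by apply: eq_bigr => i _; rewrite rmorphM mulrA.
move=> b sb; have bs : (index b s < size s)%N by rewrite index_mem.
exists (fun i => (i == Ordinal bs)%:R); rewrite (bigD1 (Ordinal bs)) //= eqxx.
rewrite rmorph1 mul1r nth_index // big1 ?addr0 // => i /negPf->.
by rewrite rmorph0 mul0r.
Qed.

End FieldQuotient.

(** Algebraicity serves to construct coefficient fields, the finite spanning family to count
    dimensions over K. *)
Lemma residue_field (K : fieldType) (R : comNzRingType) (iota : {rmorphism K -> R})
    (ys : seq R) (m : R -> Prop) : ring_gen iota ys -> is_maximal m ->
  (forall r, exists2 h : {poly K}, h != 0 & m (map_poly iota h).[r]) /\
  exists n (b : 'I_n -> R), forall r, exists c : 'I_n -> K,
    m (r - \sum_i iota (c i) * b i).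
Proof.
move=> gen [idm m1 inv]; have [L [pi [surj ker]]] := quotient_exists idm m1.
pose j : {rmorphism K -> L} := GRing.RMorphism.clone _ _ (pi \o iota) _.
have genj : ring_gen j [seq pi y | y <- ys].
  move=> S ringS Sj Sy x; have [r <-] := surj x; move: r.
  apply: gen => [|a|y yys]; last by apply: Sy; exact: map_f.
    split; first by rewrite rmorph1; exact: subring1.
      by move=> a b Sa Sb; rewrite rmorphB; exact: subringB.
    by move=> a b Sa Sb; rewrite rmorphM; exact: subringM.
  exact: Sj.
have injj := @field_rmorph_inj K L j.
have invL (x : L) : x != 0 -> exists y, x * y = 1.
  have [a <-] := surj x => a0; have [|u mu] := inv a.
    by move/ker/eqP; apply/negP.
  exists (pi u); apply/eqP; rewrite eq_sym -subr_eq0 mulrC -rmorphM -(rmorph1 pi) -rmorphB.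
  exact/eqP/ker.
have algj := zariski_alg erefl invL injj genj; split.
  move=> r; have [h h0 hr] := all_algebraic algj genj (pi r).
  exists h => //; apply/ker; rewrite -hr -horner_map -map_poly_comp.
  by [].
have [n [b bP]] := field_quotient_finite algj genj.
have [f fP] := choice surj; exists n, (fun i => f (b i)) => r.
have [c rc] := bP (pi r); exists c; apply/ker.
rewrite rmorphB rc rmorph_sum /=; apply/eqP; rewrite subr_eq0; apply/eqP.
by apply: eq_bigr => i _; rewrite rmorphM fP.
Qed.

(** * Coefficient fields of R/m^N *)

Lemma horner_addl (R : comNzRingType) (p : {poly R}) (z d : R) :
  exists q, p.[z + d] = p.[z] + p^`().[z] * d + d ^+ 2 * q.
Proof.
elim/poly_ind: p => [|p c [q IH]].
  by exists 0; rewrite deriv0 !horner0; ring.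
exists (q * (z + d) + p^`().[z]).
by rewrite derivMXaddC !(hornerD, hornerM, hornerX, hornerC) IH; ring.
Qed.

Section MonicDivision.
Variables (B : comNzRingType) (T : B -> Prop).
Hypothesis ringT : is_subring T.

Lemma poly_over_monic_div (G p : {poly B}) : G \is monic -> poly_over T G ->
  poly_over T p -> exists q r, [/\ poly_over T q, poly_over T r,
    p = q * G + r & (size r < size G)%N].
Proof.
move=> mG TG; have [sT mT] := poly_over_subring ringT.
have [n] := ubnP (size p); elim: n p => // n IH p; rewrite ltnS => sp Tp.
have [lt|le] := ltnP (size p) (size G).
  by exists 0, p; split=> //; [exact: (submod0 sT)|rewrite mul0r add0r].
have G0 : (0 < size G)%N by rewrite size_poly_gt0 monic_neq0.
pose c := p`_(size p).-1; set k := (size p - size G)%N.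
have p0 : (0 < size p)%N by exact: leq_trans le.
have sXG : (size (c *: 'X^k * G)%R <= size p)%N.
  rewrite -scalerAl (leq_trans (size_scale_leq _ _)) //.
  rewrite (leq_trans (size_polyMleq _ _)) //.
  by rewrite size_polyXn addSn /= subnK.
have Tq : poly_over T (c *: 'X^k) by apply: (submodZ sT); [exact: Tp|exact: poly_overXn].
have [||q [r [Tq' Tr E sr]]] := IH (p - c *: 'X^k * G).
- rewrite (leq_trans _ sp) // -[X in (_ < X)%N](prednK p0) ltnS.
  apply/leq_sizeP => i; rewrite leq_eqVlt => /orP[/eqP<-|].
    rewrite coefB -scalerAl coefZ coefXnM ltnNge.
    have -> : (k <= (size p).-1)%N by rewrite -ltnS prednK // /k ltn_subrL G0.
    have -> : ((size p).-1 - k)%N = (size G).-1.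
      by rewrite /k -!subn1 subnAC subKn.
    by rewrite /= -[G`_(size G).-1]/(lead_coef G) (monicP mG) mulr1 subrr.
  rewrite prednK // => si; rewrite coefB nth_default // nth_default ?subrr //.
  exact: leq_trans si.
- by apply: (submodB ringT sT) => //; exact: mT.
exists (q + c *: 'X^k), r; split=> //; first exact: (submodD sT).
by rewrite mulrDl addrAC -E subrK.
Qed.

End MonicDivision.

Section CoefficientRing.
Variables (K : fieldType) (R : comNzRingType) (iota : {rmorphism K -> R}).
Variable m : R -> Prop.
Hypotheses (perfK : perfect_field K) (maxm : is_maximal m).
Hypothesis algm : forall r, exists2 h : {poly K}, h != 0 & m (map_poly iota h).[r].
Local Notation "p ^i" := (map_poly iota p) (at level 2).

Let idm := maximal_is_ideal maxm.
Let prm := maximal_is_prime maxm.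

Lemma maximal_iota a : m (iota a) -> a = 0.
Proof.
move=> ma; apply/eqP; apply: contraT => a0; case: (maximal_proper maxm).
by rewrite -(rmorph1 iota) -(mulVf a0) rmorphM; exact: idealMl.
Qed.

Lemma minimal_poly y : exists h : {poly K},
  [/\ h != 0, m h^i.[y] &
    forall q : {poly K}, q != 0 -> m q^i.[y] -> (size h <= size q)%N].
Proof.
pose P n := `[< exists h : {poly K}, [/\ h != 0, m h^i.[y] & size h = n] >].
have exP : exists n, P n.
  by have [h h0 hy] := algm y; exists (size h); apply/asboolP; exists h.
case: (ex_minnP exP) => n /asboolP[h [h0 hy sh]] nmin; exists h; split=> // q q0 qy.
by rewrite sh; apply: nmin; apply/asboolP; exists q.
Qed.

(** A minimal polynomial is irreducible because m is prime, and perfectness makes it coprime to its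
    derivative. The Bezout identity can be evaluated in R, where it replaces an inverse of h'(y). *)
Lemma separable_annihilator y : exists h u v : {poly K},
  [/\ h != 0, m h^i.[y] & u * h + v * h^`() = 1].
Proof.
have [h [h0 hy hmin]] := minimal_poly y.
have irr : irreducible_poly h.
  split=> [|q sq qh].
    rewrite ltnNge; apply/negP => /size1_polyC hc; move: hy h0.
    by rewrite hc map_polyC hornerC /= => /maximal_iota->; rewrite polyC0 eqxx.
  have [r rq] := dvdpP _ _ qh.
  have q0 : q != 0 by apply: contra_neq h0 => q0; rewrite rq q0 mulr0.
  have r0 : r != 0 by apply: contra_neq h0 => r0; rewrite rq r0 mul0r.
  move: hy; rewrite {1}rq rmorphM hornerM => /(primeM prm)[ry|qy].
    have := hmin r r0 ry; rewrite rq size_mul //.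
    case: (size q) sq (size_poly_gt0 q) => [|[|k]]; rewrite ?q0 // => _ _.
    by rewrite !addnS /= -addnS -{2}[size r]addn0 leq_add2l.
  rewrite -dvdp_size_eqp // eqn_leq dvdp_leq //=; exact: hmin.
have := perfK irr; rewrite unlock => /Bezout_eq1_coprimepP[[u v] /= uv].
by exists h, u, v.
Qed.

Section Level.
Variable N : nat.
Let mN := ideal_exp m N.+1.
Let idN : is_ideal mN := ideal_exp_ideal N.+1 idm.

Let mNm r : mN r -> m r.
Proof. by move=> mr; apply/ideal_exp1 => //; exact: (ideal_exp_le (n := N.+1)). Qed.

(* modulo m^(N+1), [W] is a field that maps isomorphically to its image in R/m *)
Definition coef_ring (W : R -> Prop) :=
  [/\ is_subring W, forall a, W (iota a), forall r, mN r -> W r &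
      forall w, W w -> m w -> mN w].

(** Newton's iteration with v(z) in place of 1 / h'(z). Since v h' = 1 - u h, the step d = - h(z)
    v(z) gives h(z) + h'(z) d = u(z) h(z)^2, and the remaining error is a multiple of d^2. *)
Lemma hensel y : exists h u v : {poly K}, exists z,
  [/\ h != 0, u * h + v * h^`() = 1, m (z - y) & mN h^i.[z]].
Proof.
have [h [u [v [h0 hy uv]]]] := separable_annihilator y.
suff [z zy hz] : exists2 z, m (z - y) & mN h^i.[z] by exists h, u, v, z.
rewrite /mN; elim: N => [|k [z zy hz]].
  exists y; first by rewrite subrr; exact: ideal0.
  exact/ideal_exp1.
pose d := - (h^i.[z] * v^i.[z]).
have mkd : ideal_exp m k.+1 d.
  by apply: idealN; [|apply: ideal_Mr => //]; exact: ideal_exp_ideal.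
exists (z + d).
  rewrite addrAC; apply: idealD => //; apply/(ideal_exp1 _ idm).
  exact: ideal_exp_le mkd.
have [q ->] := horner_addl h^i z d.
have id2 := ideal_exp_ideal k.+2 idm; apply: idealD => //; last first.
  apply: ideal_Mr => //; rewrite expr2.
  apply: ideal_exp_le (ideal_exp_mul idm mkd mkd) => //.
  by rewrite addSn addnS !ltnS leq_addr.
have E : v^i.[z] * h^i^`().[z] = 1 - u^i.[z] * h^i.[z].
  rewrite deriv_map; have /(congr1 (fun p => p^i.[z])) := uv.
  rewrite !(rmorphD, rmorphM) /= rmorph1 hornerD !hornerM hornerC => <-.
  by rewrite addrAC subrr add0r.
have -> : h^i.[z] + h^i^`().[z] * d = h^i.[z] * (h^i.[z] * u^i.[z]).
  rewrite /d; transitivity (h^i.[z] * (1 - v^i.[z] * h^i^`().[z])); first by ring.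
  by rewrite E; ring.
apply: (ideal_exp_le (n := (k.+1 + k.+1)%N)) => //.
  by rewrite addSn addnS !ltnS leq_addr.
apply: ideal_exp_mul => //; apply: ideal_Mr => //; exact: ideal_exp_ideal.
Qed.

Section Extension.
Variable W : R -> Prop.
Hypothesis coefW : coef_ring W.

Let ringW : is_subring W. Proof. by case: coefW. Qed.
Let Wiota a : W (iota a). Proof. by case: coefW => _ /(_ a). Qed.
Let WmN r : mN r -> W r. Proof. by case: coefW => _ _ /(_ r). Qed.
Let Wm w : W w -> m w -> mN w. Proof. by case: coefW => _ _ _; apply. Qed.

Lemma poly_over_iota p : poly_over W p^i.
Proof. by move=> i; rewrite coef_map; exact: Wiota. Qed.

(** Write the minimal polynomial of w as p X + c. Then c is nonzero, as otherwise p would be a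
    smaller annihilator, and - p(w) / c inverts w modulo m. It lies in W, so the error lies in
    m^(N+1). *)
Lemma coef_ring_inv w : W w -> ~ m w -> exists2 u, W u & mN (1 - u * w).
Proof.
move=> Ww nw; have [h [h0 hw hmin]] := minimal_poly w.
have [p [c hpc]] : exists p c, h = p * 'X + c%:P.
  elim/poly_ind: h {h0 hw hmin} => [|p c _]; last by exists p, c.
  by exists 0, 0; rewrite mul0r addr0.
have Wp : W p^i.[w] by apply: subring_horner => //; exact: poly_over_iota.
have E : h^i.[w] = p^i.[w] * w + iota c.
  by rewrite hpc rmorphD rmorphM /= map_polyX map_polyC hornerMXaddC.
have c0 : c != 0.
  apply/eqP => c0; have [||//] := primeM prm (a := p^i.[w]) (b := w).
    by move: hw; rewrite E c0 rmorph0 addr0.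
  move=> mp; have p0 : p != 0.
    by apply: contra_neq h0 => p0; rewrite hpc p0 c0 mul0r addr0.
  by have := hmin p p0 mp; rewrite hpc c0 addr0 size_mulX // ltnn.
exists (- (iota c^-1 * p^i.[w])).
  by apply: subringN => //; apply: subringM.
apply: Wm.
  apply: subringB => //; first exact: subring1.
  by apply: subringM => //; apply: subringN => //; apply: subringM.
have -> : 1 - - (iota c^-1 * p^i.[w]) * w = iota c^-1 * h^i.[w].
  rewrite E mulrDr -rmorphM mulVf // rmorph1; ring.
exact: idealMl.
Qed.

(** The extension is W[z] + m^(N+1) with z from [hensel]. A monic G over W of least degree with G(z)
    in m may be smaller than h; separability of h forces G(z) into m^(N+1), so that division by G
    controls the elements of W[z] in m. *)
Lemma coef_ring_extend y : exists W', [/\ coef_ring W', forall w, W w -> W' w &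
  exists2 z, W' z & m (z - y)].
Proof.
have [h [u [v [z [h0 uv zy hz]]]]] := hensel y.
have [sW mW] := poly_over_subring ringW.
pose P n := `[< exists G : {poly R},
  [/\ G \is monic, poly_over W G, m G.[z] & size G = n] >].
have exP : exists n, P n.
  pose G := ((lead_coef h)^-1 *: h)^i.
  exists (size G); apply/asboolP; exists G; split=> //.
  - by rewrite map_monic monicE lead_coefZ mulVf // lead_coef_eq0.
  - exact: poly_over_iota.
  - by rewrite /G linearZ hornerZ; apply: idealMl => //; exact: mNm.
case: (ex_minnP exP) => n /asboolP[G [mG WG Gz sG]] nmin.
(* A leading coefficient outside m could be inverted in W, which would contradict the minimality of
   G. *)
have small r : poly_over W r -> m r.[z] -> (size r < size G)%N -> forall i, mN r`_i.
  have [k] := ubnP (size r); elim: k r => // k IH r; rewrite ltnS => sr Wr rz rG i.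
  have [r0|r0] := eqVneq (size r) 0%N.
    by rewrite nth_default ?r0 //; exact: ideal0.
  have [l sl] : exists l, size r = l.+1 by exists (size r).-1; rewrite prednK // lt0n.
  set c := r`_l; have [mc|nc] := pselect (m c); last first.
    have [c' Wc' c'c] := coef_ring_inv (Wr l) nc.
    (* The second term makes the leading coefficient exactly 1; its own coefficient lies in
       m^(N+1). *)
    pose r' := c' *: r + (1 - c' * c) *: 'X^l.
    have sr' : (size r' <= l.+1)%N.
      rewrite (leq_trans (size_polyD _ _)) // geq_max; apply/andP.
      by split; apply: (leq_trans (size_scale_leq _ _)); rewrite ?sl ?size_polyXn.
    have r'l : r'`_l = 1 by rewrite coefD !coefZ coefXn eqxx mulr1 addrC subrK.
    have sr'E : size r' = l.+1.
      apply/eqP; rewrite eqn_leq sr' ltnNge; apply/negP => /leq_sizeP/(_ l (leqnn _)).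
      by rewrite r'l; apply/eqP; exact: oner_neq0.
    have /nmin : P l.+1.
      apply/asboolP; exists r'; split=> //.
      - by rewrite monicE lead_coefE sr'E r'l.
      - apply: (submodD sW); apply: (submodZ sW) => //; last exact: poly_overXn.
        exact: WmN.
      - rewrite hornerD !hornerZ hornerXn; apply: idealD => //; first exact: idealMl.
        by apply: ideal_Mr => //; exact: mNm.
    by rewrite -sG -sl leqNgt rG.
  have mNc : mN c by apply: Wm => //; exact: Wr.
  have rlt : (size (r - c *: 'X^l)%R <= l)%N.
    apply/leq_sizeP => t; rewrite leq_eqVlt coefB coefZ coefXn => /orP[/eqP<-|lt].
      by rewrite eqxx mulr1 subrr.
    by rewrite gtn_eqF // mulr0 subr0 nth_default // sl.
  apply: (ideal_congr idN (b := (r - c *: 'X^l)`_i)).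
    rewrite coefB subKr coefZ; exact: ideal_Mr.
  apply: IH.
  - by rewrite (leq_ltn_trans rlt) // -sl.
  - apply: (submodB ringW sW) => //; apply: (submodZ sW); first exact: Wr.
    exact: poly_overXn.
  - rewrite hornerD hornerN hornerZ; apply: idealB => //; apply: ideal_Mr => //.
  - by rewrite (leq_ltn_trans rlt) // -sl ltnW.
have mN_horner (r : {poly R}) : (forall i, mN r`_i) -> mN r.[z].
  by move=> mr; rewrite horner_coef; apply: ideal_sum => // i _; exact: ideal_Mr.
have mGz : mN G.[z].
  have [q [r [Wq Wr E sr]]] := poly_over_monic_div ringW mG WG (poly_over_iota h).
  have mr : forall i, mN r`_i.
    apply: small => //; have -> : r = h^i - q * G by rewrite E addrC addKr.
    rewrite hornerD hornerN hornerM; apply: idealB => //; first exact: mNm.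
    exact: idealMl.
  have qGz : mN (q.[z] * G.[z]).
    have -> : q.[z] * G.[z] = h^i.[z] - r.[z] by rewrite E hornerD hornerM addrK.
    by apply: idealB => //; exact: mN_horner.
  (* Otherwise h = q G + r would have a double root at z modulo m, against u h + v h' = 1. *)
  have nq : ~ m q.[z].
    move=> mq; apply: (maximal_proper maxm).
    have -> : 1 = (u * h + v * h^`())^i.[z] by rewrite uv rmorph1 hornerC.
    rewrite rmorphD !rmorphM hornerD !hornerM; apply: idealD => //.
      by apply: idealMl => //; exact: mNm.
    apply: idealMl => //; rewrite /= -deriv_map E derivD derivM !hornerD !hornerM.
    apply: idealD => //; first by apply: idealD => //; [exact: idealMl|exact: ideal_Mr].
    apply/mNm/mN_horner => i; rewrite coef_deriv -mulr_natr; exact: ideal_Mr.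
  have [t mt] := maximal_inv_exp N.+1 maxm nq.
  apply: (ideal_congr idN (b := t * (q.[z] * G.[z]))); last exact: idealMl.
  by rewrite mulrA -{1}[G.[z]]mul1r -mulrBl; exact: ideal_Mr.
pose W' x := exists2 p, poly_over W p & mN (x - p.[z]).
exists W'; split; last first.
- exists z => //; exists 'X; first exact: (poly_overXn ringW 1).
  by rewrite hornerX subrr; exact: ideal0.
- move=> w Ww; exists w%:P; first exact: poly_overC.
  by rewrite hornerC subrr; exact: ideal0.
split.
- split.
  + exists 1%:P; first by apply: poly_overC => //; exact: subring1.
    by rewrite hornerC subrr; exact: ideal0.
  + move=> a b [p Wp ap] [q Wq bq]; exists (p - q); first exact: (submodB ringW sW).
    rewrite hornerD hornerN (_ : _ - _ = (a - p.[z]) - (b - q.[z])); last by ring.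
    exact: idealB.
  + move=> a b [p Wp ap] [q Wq bq]; exists (p * q); first exact: mW.
    rewrite hornerM (_ : _ - _ = (a - p.[z]) * b + p.[z] * (b - q.[z])); last by ring.
    by apply: idealD => //; [exact: ideal_Mr|exact: idealMl].
- move=> a; exists (iota a)%:P; first by exact: poly_overC.
  by rewrite hornerC subrr; exact: ideal0.
- move=> r mr; exists 0; first exact: (submod0 sW).
  by rewrite horner0 subr0.
move=> w [p Wp wp] mw.
have [q [r [Wq Wr E sr]]] := poly_over_monic_div ringW mG WG Wp.
apply: (ideal_congr idN wp); rewrite E hornerD hornerM; apply: idealD => //.
  exact: idealMl.
apply: mN_horner; apply: small => //.
have -> : r.[z] = w - (w - p.[z]) - q.[z] * G.[z] by rewrite E hornerD hornerM; ring.
by apply: idealB => //; [apply: idealB => //; exact: mNm|exact: idealMl].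
Qed.

End Extension.

(** Starting from the image of K plus m^(N+1), lifts of the generators are adjoined one by one. The
    elements congruent modulo m to one of W form a subring, hence are all of R. *)
Lemma coef_ring_exists ys : ring_gen iota ys ->
  exists W, coef_ring W /\ forall r, exists2 w, W w & m (r - w).
Proof.
move=> gen.
have [W [cW Wy]] : exists W, coef_ring W /\
    forall y, y \in ys -> exists2 w, W w & m (y - w).
  elim: ys {gen} => [|y ys [W [cW Wy]]].
    exists (fun x => exists a, mN (x - iota a)); split=> //; split.
    - split; first by exists 1; rewrite rmorph1 subrr; exact: ideal0.
      + move=> a b [a' aa] [b' bb]; exists (a' - b').
        rewrite rmorphB (_ : _ - _ = (a - iota a') - (b - iota b')); last by ring.
        exact: idealB.
      + move=> a b [a' aa] [b' bb]; exists (a' * b'); rewrite rmorphM.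
        rewrite (_ : _ - _ = (a - iota a') * b + iota a' * (b - iota b')); last by ring.
        by apply: idealD => //; [exact: ideal_Mr|exact: idealMl].
    - by move=> a; exists a; rewrite subrr; exact: ideal0.
    - by move=> r mr; exists 0; rewrite rmorph0 subr0.
    - move=> w [a wa] mw; have -> : w = w - iota a; last by [].
      rewrite (@maximal_iota a) ?rmorph0 ?subr0 //.
      have -> : iota a = w - (w - iota a) by ring.
      by apply: idealB => //; exact: mNm.
  have [W' [cW' WW' [z W'z zy]]] := coef_ring_extend cW y.
  exists W'; split=> // x; rewrite inE => /orP[/eqP->|/Wy[w /WW' ? ?]]; last by exists w.
  by exists z => //; exact: idealBC.
have ringW : is_subring W by case: cW.
exists W; split=> //; apply: gen => // [|a]; last first.
  by exists (iota a); [case: cW|rewrite subrr; exact: ideal0].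
split; first by exists 1; [exact: subring1|rewrite subrr; exact: ideal0].
- move=> a b [a' ? aa] [b' ? bb]; exists (a' - b'); first exact: subringB.
  by rewrite (_ : _ - _ = (a - a') - (b - b')); [exact: idealB|ring].
- move=> a b [a' ? aa] [b' ? bb]; exists (a' * b'); first exact: subringM.
  rewrite (_ : _ - _ = (a - a') * b + a' * (b - b')); last by ring.
  by apply: idealD => //; [exact: ideal_Mr|exact: idealMl].
Qed.

End Level.
End CoefficientRing.

(** * Growth of R/m^n *)

Section IndependentFamilies.
Variables (K : fieldType) (R : comNzRingType) (iota : {rmorphism K -> R}).
Implicit Types (J P m : R -> Prop).

(** For an ideal J this says dim_K R/J >= n, without forming the quotient. *)
Definition indep J n := exists u : 'I_n -> R, forall c : 'I_n -> K,
  J (\sum_i iota (c i) * u i) -> forall i, c i = 0.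

Lemma indep_sub J J' n : (forall a, J a -> J' a) -> indep J' n -> indep J n.
Proof. by move=> JJ' [u uP]; exists u => c /JJ'; exact: uP. Qed.

(** Dimensions add along 0 -> R/(J : x) -> R/J -> R/(J + R x) -> 0; J1 and J2 may be larger than J +
    R x and J : x. *)
Lemma indep_colon J J1 J2 x p q : is_ideal J ->
  (forall a r, J (a - r * x) -> J1 a) -> (forall r, J (r * x) -> J2 r) ->
  indep J1 p -> indep J2 q -> indep J (p + q).
Proof.
move=> idJ JJ1 JJ2 [u uP] [v vP].
exists (fun i => match split i with inl i => u i | inr i => v i * x end) => c.
rewrite big_split_ord /=.
under eq_bigr do rewrite (unsplitK (inl _)).
under [X in _ + X]eq_bigr do rewrite (unsplitK (inr _)) mulrA.
rewrite -mulr_suml => Jc; have c1 : forall i, c (lshift q i) = 0.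
  apply: (uP (fun i => c (lshift q i))).
  apply: (JJ1 _ (- \sum_i iota (c (rshift p i)) * v i)).
  by rewrite mulNr opprK.
have c2 : forall i, c (rshift p i) = 0.
  apply: (vP (fun i => c (rshift p i))); apply: JJ2; move: Jc.
  by rewrite big1 ?add0r // => i _; rewrite c1 rmorph0 mul0r.
by move=> i; rewrite -(splitK i); case: (split i).
Qed.

Lemma indep_span J n (T : finType) (b : T -> R) : is_ideal J ->
  (forall r, exists c : T -> K, J (r - \sum_t iota (c t) * b t)) ->
  indep J n -> (n <= #|T|)%N.
Proof.
move=> idJ bP [u uP]; have [f fP] := choice (fun i => bP (u i)).
pose A := \matrix_(i < n, k < #|T|) f i (enum_val k).
rewrite leqNgt; apply/negP => lt.
have /rowV0Pn[w /sub_kermxP wA] : kermx A != 0.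
  rewrite kermx_eq0 -row_leq_rank -ltnNge; apply: leq_ltn_trans lt; exact: rank_leq_col.
case/eqP/rowP => i; rewrite mxE; apply: (uP (fun i => w 0 i)).
have -> : \sum_k iota (w 0 k) * u k =
    \sum_k iota (w 0 k) * (u k - \sum_t iota (f k t) * b t).
  apply/eqP; rewrite -subr_eq0 -sumrB.
  under eq_bigr do rewrite -mulrBr subKr mulr_sumr.
  rewrite exchange_big big1 //= => t _.
  have /(congr1 (fun B : 'rV_#|T| => B 0 (enum_rank t))) := wA; rewrite !mxE => wAt.
  under eq_bigr do rewrite mulrA -rmorphM.
  rewrite -mulr_suml -rmorph_sum /=.
  rewrite (_ : \sum_k _ = 0) ?rmorph0 ?mul0r // -[RHS]wAt.
  by apply: eq_bigr => k _; rewrite mxE enum_rankK.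
by apply: ideal_sum => // k _; exact: idealMl.
Qed.

(** For x in P_1 outside P_0, Artin-Rees and [indep_colon] bound the dimension for P_0 + m^N below
    by those for P_1 + m^N, with a shorter chain, and P_0 + m^(N-a0), with a smaller n. The two add
    up by Pascal's rule. *)
Lemma indep_chain m d (P : nat -> R -> Prop) : noetherian R -> is_maximal m ->
  (forall i, (i <= d)%N -> is_prime (P i) /\ forall a, P i a -> m a) ->
  (forall i, (i < d)%N -> (forall a, P i a -> P i.+1 a) /\
     exists2 x, P i.+1 x & ~ P i x) ->
  exists a c, forall n, indep (ideal_add (P 0) (ideal_exp m (a * n + c))) 'C(n + d, d).
Proof.
move=> noethR maxm; have idm := maximal_is_ideal maxm.
have idE := @ideal_exp_ideal _ _ _ idm.
elim: d P => [|d IH] P primeP ltP.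
  exists 0%N, 1%N => n; rewrite addn0 bin0 mul0n add0n; exists (fun=> 1) => c.
  rewrite big_ord1 mulr1 => -[a Pa /(ideal_exp1 _ idm) mc] i; rewrite ord1.
  have m_iota : m (iota (c ord0)).
    by apply: (ideal_congr idm mc); case: (primeP 0%N isT) => _; apply.
  apply/eqP; apply: contraT => c0; case: (maximal_proper maxm).
  by rewrite -(rmorph1 iota) -(mulVf c0) rmorphM; exact: idealMl.
have [|i id|a' [c a'c]] := IH (fun i => P i.+1).
- by move=> i id; exact: primeP.
- exact: ltP.
have [P01 [x P1x P0x]] := ltP 0%N isT.
have [primeP0 _] := primeP 0%N isT; have [primeP1 _] := primeP 1%N isT.
have [a0 a0P] := artin_rees noethR idm primeP0 P0x.
have idP0 := prime_ideal primeP0; have idP1 := prime_ideal primeP1.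
(* Raising n by one raises the exponent by a, which covers the loss a0 of Artin-Rees; a >= a' keeps
   the bound of the shorter chain available. *)
pose a := maxn a0 a'; exists a, c; elim=> [|n IHn].
  rewrite muln0 add0n !add0n binn; have := a'c 0%N; rewrite muln0 !add0n binn.
  by apply: indep_sub => b [b0 /P01 ? ?]; exists b0.
rewrite addSn binS [X in indep _ X]addnC; have := a'c n.+1; rewrite addSnnS => a'cn.
apply: (indep_colon (x := x) _ _ _ a'cn IHn); first exact: ideal_add_ideal.
- move=> b r [b0 P0b mb]; exists (b0 + r * x).
    by apply: idealD => //; [exact: P01|exact: idealMl].
  rewrite opprD addrA addrAC; apply: ideal_exp_le mb => //.
  by rewrite leq_add2r leq_mul2r leq_maxr orbT.
- move=> r /a0P[b0 P0b mb]; exists b0 => //; apply: ideal_exp_le mb => //.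
  by have := leq_maxl a0 a'; rewrite -/a mulnS; lia.
Qed.

End IndependentFamilies.

(** * Forms in the parameters and the associated graded ring *)

Section Monomials.
Variables (R : comNzRingType) (m : R -> Prop) (d : nat) (x : 'I_d -> R).
Hypotheses (idm : is_ideal m) (mx : forall i, m (x i)).
Hypothesis genx : forall a, m a -> exists c : 'I_d -> R,
  ideal_exp m 2 (a - \sum_i c i * x i).

Definition mon (a : 'X_{1..d}) : R := \prod_(i < d) x i ^+ a i.

Lemma monD a b : mon (a + b)%MM = mon a * mon b.
Proof. by rewrite /mon -big_split; apply: eq_bigr => i _; rewrite mnmDE exprD. Qed.

Lemma meval_mon (F : {mpoly R[d]}) : F.@[x] = \sum_(a <- msupp F) F@_a * mon a.
Proof. by rewrite mevalE. Qed.

Lemma ideal_exp_mon a : ideal_exp m (mdeg a) (mon a).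
Proof.
rewrite mdegE /mon; apply: (big_ind2 (fun k r => ideal_exp m k r)) => //.
  by move=> k r l s; exact: ideal_exp_mul.
by move=> i _; exact: ideal_exp_X.
Qed.

(** Forms map onto the associated graded ring of m; [quasi_regular] is the corresponding injectivity
    over R/m. *)
Lemma ideal_exp_homog k r : ideal_exp m k r ->
  exists2 F : {mpoly R[d]}, F \is k.-homog & ideal_exp m k.+1 (r - F.@[x]).
Proof.
have idE := @ideal_exp_ideal _ _ _ idm.
elim: k r => [|k IH] r.
  move=> _; exists r%:MP; last by rewrite mevalC subrr; exact: ideal0.
  apply/dhomogP => a; rewrite msuppC; case: ifP => // _.
  by rewrite inE => /eqP->; exact: mdeg0.
move=> [s [sP ->]]; rewrite big_seq.
apply: (big_ind (fun r => exists2 F : {mpoly R[d]}, F \is k.+1.-homog &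
    ideal_exp m k.+2 (r - F.@[x]))).
- by exists 0; [exact: dhomog0|rewrite meval0 subr0; exact: ideal0].
- move=> a b [F hF aF] [G hG bG]; exists (F + G); first exact: rpredD.
  by rewrite mevalD opprD addrACA; exact: idealD.
move=> c /sP[/genx[e me] mc]; have [F hF bF] := IH _ mc.
pose G : {mpoly R[d]} := \sum_i e i *: 'X_i.
have hG : G \is 1.-homog.
  apply: rpred_sum => i _; apply: rpredZ; rewrite dhomogX; apply/eqP; exact: mdeg1.
have GE : G.@[x] = \sum_i e i * x i.
  by rewrite /G raddf_sum; apply: eq_bigr => i _; rewrite /= mevalZ mevalXU.
exists (G * F); first exact: (dhomogM hG hF).
rewrite mevalM GE; set g := \sum_i _ in me *.
rewrite (_ : _ - _ = (c.1 - g) * c.2 + g * (c.2 - F.@[x])); last by ring.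
apply: idealD => //.
  by rewrite -[k.+2]/(2 + k)%N; exact: ideal_exp_mul.
rewrite -[k.+2]/(1 + k.+1)%N; apply: ideal_exp_mul => //; apply/ideal_exp1 => //.
by apply: ideal_sum => // i _; exact: idealMl.
Qed.

End Monomials.

Lemma max_seq (disp : Order.disp_t) (T : orderType disp) (s : seq T) : s != [::] ->
  exists2 b, b \in s & forall c, c \in s -> (c <= b)%O.
Proof.
elim: s => // a s IH _; have [->|/IH[b bs bmax]] := eqVneq s [::].
  by exists a; rewrite ?mem_head // => c; rewrite inE => /eqP->.
have [ab|ba] := leP a b.
  exists b; first by rewrite inE bs orbT.
  by move=> c; rewrite inE => /orP[/eqP->|/bmax].
exists a; first exact: mem_head.
move=> c; rewrite inE => /orP[/eqP->//|/bmax cb].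
exact: le_trans cb (ltW ba).
Qed.

(** Gives n^d <= d! C(n + d, d), the lower bound for the growth. *)
Lemma leq_expn_ffact n k : (n ^ k <= (n + k) ^_ k)%N.
Proof.
elim: k => // k IH; rewrite addnS ffactSS expnS; apply: leq_mul => //.
by rewrite ltnW // ltnS leq_addr.
Qed.

Section Counting.
Variables (K : fieldType) (R : comNzRingType) (iota : {rmorphism K -> R}).
Variables (m : R -> Prop) (d : nat) (x : 'I_d -> R).
Hypotheses (maxm : is_maximal m) (mx : forall i, m (x i)).
Hypothesis genx : forall a, m a -> exists c : 'I_d -> R,
  ideal_exp m 2 (a - \sum_i c i * x i).
Variables (e : nat) (y : 'I_e -> R).
Hypothesis geny : forall r, exists c : 'I_e -> K, m (r - \sum_i iota (c i) * y i).

Let idm := maximal_is_ideal maxm.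
Let idE := fun n => ideal_exp_ideal n idm.

(* A homogeneous relation with leading monomial [b] makes the multiples of [b]
   redundant, so that R/m^N is spanned by O(N^(d-1)) elements. *)
Lemma relation_bound (F : {mpoly R[d]}) k b N n : F \is k.-homog ->
  ideal_exp m k.+1 F.@[x] -> ~ m F@_b ->
  (forall c, c \in msupp F -> (b < c)%O -> m F@_c) ->
  indep iota (ideal_exp m N) n -> (n <= e * (d * (mdeg b * N ^ d.-1)))%N.
Proof.
move=> hF mF nFb maxb.
have Fb0 : b \in msupp F.
  by apply: contraT => /memN_msupp_eq0 Fb; case: nFb; rewrite Fb; exact: ideal0.
have kb : mdeg b = k by exact: (dhomogP _ _ _ hF).
(* The monomials not divisible by b, with exponents below N; times the y_i, they will span R/m^N
   over K. *)
pose nondiv (a : {ffun 'I_d -> 'I_N}) := [exists i, (a i < b i)%N].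
pose T : finType := ('I_e * {a : {ffun 'I_d -> 'I_N} | nondiv a})%type.
pose mn (a : {ffun 'I_d -> 'I_N}) : 'X_{1..d} := [multinom (a i : nat) | i < d].
pose w (t : T) : R := y t.1 * mon x (mn (sval t.2)).
pose Sp r := exists c : T -> K, ideal_exp m N (r - \sum_t iota (c t) * w t).
have Sp_ideal r : ideal_exp m N r -> Sp r.
  by move=> mr; exists (fun=> 0); rewrite big1 ?subr0 // => t _; rewrite rmorph0 mul0r.
have SpD r s : Sp r -> Sp s -> Sp (r + s).
  move=> [c mr] [c' ms]; exists (fun t => c t + c' t).
  under eq_bigr do rewrite rmorphD mulrDl.
  by rewrite big_split opprD addrACA; exact: idealD.
have SpZ a r : Sp r -> Sp (iota a * r).
  move=> [c mr]; exists (fun t => a * c t).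
  under eq_bigr do rewrite rmorphM -mulrA.
  by rewrite -mulr_sumr -mulrBr; exact: idealMl.
have Sp_sum (I : Type) (s : seq I) (P : pred I) (G : I -> R) :
    (forall i, P i -> Sp (G i)) -> Sp (\sum_(i <- s | P i) G i).
  by move=> SG; apply: (big_ind Sp) => //; apply: Sp_ideal; exact: ideal0.
have Sp_mem t : Sp (w t).
  exists (fun t' => (t' == t)%:R); rewrite (bigD1 t) //= eqxx rmorph1 mul1r big1 ?addr0.
    by rewrite subrr; exact: ideal0.
  by move=> t' /negPf->; rewrite rmorph0 mul0r.
(* Induction on the monomial order within degree i. If b divides a, then F trades x^a for smaller
   monomials, up to m^(i+1): there lie the multiple of F(x) and the terms above b, whose
   coefficients are in m. *)
have Sp_mon i : (i < N)%N -> (forall r, ideal_exp m i.+1 r -> Sp r) ->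
    forall a, mdeg a = i -> forall r, Sp (r * mon x a).
  move=> iN Spi; apply: ltmwf => a IHa ai r.
  have Sp_m s : m s -> Sp (s * mon x a).
    move=> ms; apply: (Spi); rewrite -ai; apply: (ideal_exp_mul (i := 1)) => //.
      exact/ideal_exp1.
    exact: ideal_exp_mon.
  have [ba|nba] := boolP (b <= a)%MM; last first.
    have [c mc] := geny r; rewrite -(subrK (\sum_l iota (c l) * y l) r) mulrDl.
    apply: (SpD); first exact: Sp_m.
    rewrite mulr_suml; apply: (Sp_sum) => l _; rewrite -mulrA; apply: (SpZ).
    have aN l' : (a l' < N)%N.
      by apply: leq_ltn_trans iN; rewrite -ai mdegE (bigD1 l') //= leq_addr.
    pose a' : {ffun 'I_d -> 'I_N} := [ffun l' => Ordinal (aN l')].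
    have nd : nondiv a'.
      move: nba; rewrite negb_forall => /existsP[l' nl']; apply/existsP; exists l'.
      by rewrite ffunE /= ltnNge.
    have := Sp_mem (l, exist _ a' nd); rewrite /w /=; congr (Sp (_ * mon x _)).
    by apply/mnmP => l'; rewrite mnmE ffunE.
  have [u mu] := maximal_inv maxm nFb.
  set g := (a - b)%MM; have aE : a = (g + b)%MM by rewrite /g submK.
  have gk : (mdeg g + k)%N = i by rewrite -kb -mdegD -aE.
  rewrite -[r]mulr1 -(subrK (u * F@_b) 1) mulrDr mulrDl.
  apply: (SpD); first by apply: Sp_m; exact: idealMl.
  have -> : r * (u * F@_b) * mon x a = r * u * mon x g * F.@[x] -
      \sum_(c <- rem b (msupp F)) r * u * F@_c * mon x (g + c)%MM.
    rewrite meval_mon (big_rem b) //= aE monD mulrDr mulr_sumr.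
    under [X in _ - X]eq_bigr do rewrite monD.
    rewrite -addrA -sumrB big1 ?addr0; first by ring.
    by move=> c _; ring.
  apply: (SpD).
    apply: (Spi); rewrite -gk -addnS -mulrA; apply: idealMl => //.
    by apply: ideal_exp_mul => //; exact: ideal_exp_mon.
  rewrite -sumrN big_seq; apply: (Sp_sum) => c.
  rewrite (mem_rem_uniq _ (msupp_uniq _)) inE => /andP[cb cF]; rewrite -mulNr.
  have ck : mdeg c = k by exact: (dhomogP _ _ _ hF).
  case: (ltgtP c b) cb => // [lt|gt] _.
    by apply: (IHa); [rewrite aE ltmc_add2r|rewrite mdegD ck].
  apply: (Spi); rewrite -gk -ck -mdegD -addn1 mulrC; apply: ideal_exp_mul => //.
    exact: ideal_exp_mon.
  by apply/ideal_exp1 => //; apply: idealN => //; apply: idealMl => //; exact: maxb.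
(* Descending induction on the power of m, starting at m^N. *)
have Sp_exp i : (i <= N)%N -> forall r, ideal_exp m (N - i) r -> Sp r.
  elim: i => [|i IH] iN r; first by rewrite subn0; exact: Sp_ideal.
  move=> /(ideal_exp_homog idm mx genx)[G hG mG].
  rewrite -(subrK G.@[x] r); apply: (SpD).
    by apply: IH; [exact: ltnW|rewrite -subnSK].
  rewrite meval_mon big_seq; apply: (Sp_sum) => a aG.
  apply: (Sp_mon (N - i.+1)%N); first by rewrite ltn_subrL (leq_trans _ iN).
    by rewrite subnSK //; apply: IH; exact: ltnW.
  exact: (dhomogP _ _ _ hG).
move=> /(indep_span (b := w) (idE N)) => /(_ _)/leq_trans; apply.
  by move=> r; apply: (Sp_exp N) => //; rewrite subnn.
rewrite card_prod card_ord leq_mul2l; apply/orP; right.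
rewrite card_sig.
(* Some coordinate is below that of b: this leaves at most [mdeg b] values for it and N for each of
   the d - 1 others. *)
apply: (leq_trans (n := \sum_(i < d) #|[pred a : {ffun 'I_d -> 'I_N} | (a i < b i)%N]|)).
  rewrite -sum1_card
    (eq_bigr (fun i => \sum_(a : {ffun 'I_d -> 'I_N} | (a i < b i)%N) 1)%N);
    last by move=> i _; rewrite -sum1_card.
  rewrite (exchange_big_dep nondiv) /=; last first.
    by move=> i a _ ai; apply/existsP; exists i.
  apply: leq_sum => a /existsP[i ai].
  by rewrite (bigD1 i).
rewrite -[X in (_ <= X * _)%N]card_ord -sum_nat_const; apply: leq_sum => i _.
pose D (l : 'I_d) : pred 'I_N := fun t => (l == i) ==> (t < b i)%N.
have -> : #|[pred a : {ffun 'I_d -> 'I_N} | (a i < b i)%N]| = #|family D|.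
  apply: eq_card => a; rewrite inE; apply/idP/familyP => [ai l|/(_ i)]; last first.
    by rewrite unfold_in /= eqxx.
  by rewrite unfold_in; apply/implyP => /eqP->.
rewrite card_family foldrE big_map big_enum /= (bigD1 i) //=.
apply: leq_mul.
  apply: (leq_trans (n := b i)); last by rewrite mdegE (bigD1 i) //= leq_addr.
  rewrite cardE -(size_map val) -[X in (_ <= X)%N](size_iota 0); apply: uniq_leq_size.
    by rewrite map_inj_uniq ?enum_uniq //; exact: val_inj.
  by move=> _ /mapP[t + ->]; rewrite mem_enum unfold_in eqxx mem_iota.
apply: (leq_trans (n := \prod_(l < d | l != i) N)).
  by apply: leq_prod => l _; rewrite -[X in (_ <= X)%N]card_ord max_card.
by rewrite prod_nat_const cardC1 card_ord.
Qed.

(* By [indep_chain] the quotient R/m^N has dimension at least c N^d, which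
   excludes the bound of [relation_bound]. *)
Theorem quasi_regular (P : nat -> R -> Prop) (F : {mpoly R[d]}) k :
  noetherian R ->
  (forall i, (i <= d)%N -> is_prime (P i) /\ forall a, P i a -> m a) ->
  (forall i, (i < d)%N -> (forall a, P i a -> P i.+1 a) /\
     exists2 z, P i.+1 z & ~ P i z) ->
  F \is k.-homog -> ideal_exp m k.+1 F.@[x] -> forall b, m F@_b.
Proof.
move=> noethR primeP ltP hF mF b0; apply: contrapT => nb0.
pose s := [seq b <- msupp F | ~~ `[< m F@_b >]].
have [|b bs bmax] := @max_seq _ _ s.
  have: b0 \in s; last by case: s.
  rewrite mem_filter; apply/andP; split; first by apply/asboolPn.
  by apply: contraT => /memN_msupp_eq0 Fb; case: nb0; rewrite Fb; exact: ideal0.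
move: bs; rewrite mem_filter => /andP[/asboolPn nb bF].
have maxb c : c \in msupp F -> (b < c)%O -> m F@_c.
  move=> cF bc; apply: contrapT => nc; have /bmax : c \in s.
    by rewrite mem_filter cF andbT; apply/asboolPn.
  by rewrite leNgt bc.
have [a [c acP]] := indep_chain iota noethR maxm primeP ltP.
(* n is chosen to contradict n^d <= d! C(n + d, d) <= q d! (a n + c)^(d-1), because a n + c <= (a +
   c) n. For d = 0 the constant q is 0. *)
pose mb := mdeg b; pose q := (e * (d * mb))%N; pose n := (q * d`! * (a + c) ^ d.-1).+1.
have lt : (n ^ d <= q * d`! * (a * n + c) ^ d.-1)%N.
  apply: leq_trans (leq_expn_ffact n d) _; rewrite -bin_ffact.
  rewrite [X in (_ <= X)%N]mulnAC leq_mul2r; apply/orP; right.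
  have ind : indep iota (ideal_exp m (a * n + c)) 'C(n + d, d).
    apply: indep_sub (acP n) => r mr; exists 0; last by rewrite subr0.
    by apply: ideal0; apply: prime_ideal; case: (primeP 0%N isT).
  by have := relation_bound hF mF nb maxb ind; rewrite /q /mb !mulnA.
have [d0|d0] := posnP d; first by move: lt; rewrite /q d0 muln0 !mul0n.
have : (n * n ^ d.-1 <= q * d`! * (a + c) ^ d.-1 * n ^ d.-1)%N.
  rewrite -expnS prednK // (leq_trans lt) // -[X in (_ <= X)%N]mulnA leq_mul2l -expnMn.
  apply/orP; right; case: (d.-1) => // l; rewrite leq_exp2r // mulnDl leq_add2l.
  by rewrite leq_pmulr.
by rewrite leq_pmul2r ?expn_gt0 // ltnn.
Qed.

End Counting.

(** * The higher derivation defined by the grading *)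

Section Grading.
Variables (K : fieldType) (R : comNzRingType) (iota : {rmorphism K -> R}).
Variables (m : R -> Prop) (d : nat) (x : 'I_d -> R) (N : nat) (W : R -> Prop).
Hypotheses (maxm : is_maximal m) (mx : forall i, m (x i)).
Hypothesis genx : forall a, m a -> exists c : 'I_d -> R,
  ideal_exp m 2 (a - \sum_i c i * x i).
Hypothesis qreg : forall (F : {mpoly R[d]}) k, F \is k.-homog ->
  ideal_exp m k.+1 F.@[x] -> forall b, m F@_b.
Hypothesis coefW : coef_ring iota m N W.
Hypothesis genW : forall r, exists2 w, W w & m (r - w).

Let idm := maximal_is_ideal maxm.
Let idE := fun n => ideal_exp_ideal n idm.
Let mN := ideal_exp m N.+1.
Let idN : is_ideal mN := idE N.+1.
Let ringW : is_subring W. Proof. by case: coefW. Qed.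
Let Wiota a : W (iota a). Proof. by case: coefW => _ /(_ a). Qed.
Let Wm w : W w -> m w -> mN w. Proof. by case: coefW => _ _ _; apply. Qed.

Let mN_le n r : (n <= N.+1)%N -> mN r -> ideal_exp m n r.
Proof. by move=> nN; exact: ideal_exp_le. Qed.

Definition graded_part k r := exists F : {mpoly R[d]},
  [/\ F \is k.-homog, forall a, W F@_a & mN (r - F.@[x])].

(** Such a Q is a decomposition of Q(1) into homogeneous components, the power of t recording the
    degree. *)
Definition graded (Q : {poly R}) := forall k, graded_part k Q`_k.

Lemma homog_meval k (F : {mpoly R[d]}) : F \is k.-homog -> ideal_exp m k F.@[x].
Proof.
move=> hF; rewrite meval_mon; apply: ideal_sum_seq => // a aF; apply: idealMl => //.
by rewrite -(dhomogP _ _ _ hF _ aF); exact: ideal_exp_mon.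
Qed.

Lemma graded_part0 k : graded_part k 0.
Proof.
exists 0; split; first exact: dhomog0.
  by move=> a; rewrite mcoeff0; exact: subring0.
by rewrite meval0 subr0; exact: ideal0.
Qed.

Lemma graded_partB k a b : graded_part k a -> graded_part k b -> graded_part k (a - b).
Proof.
move=> [F [hF WF aF]] [G [hG WG bG]]; exists (F - G); split.
- exact: rpredB.
- by move=> c; rewrite mcoeffB; exact: subringB.
- by rewrite mevalB (_ : _ - _ = (a - F.@[x]) - (b - G.@[x])); [exact: idealB|ring].
Qed.

Lemma graded_partD k a b : graded_part k a -> graded_part k b -> graded_part k (a + b).
Proof.
move=> ga gb; rewrite -[b]opprK -[- b]sub0r; apply: graded_partB => //.
by apply: graded_partB => //; exact: graded_part0.
Qed.

Lemma graded_partM i j a b : graded_part i a -> graded_part j b ->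
  graded_part (i + j) (a * b).
Proof.
move=> [F [hF WF aF]] [G [hG WG bG]]; exists (F * G); split.
- exact: dhomogM.
- by move=> c; rewrite mcoeffM; apply: subring_sum => // p _; exact: subringM.
- rewrite mevalM (_ : _ - _ = (a - F.@[x]) * b + F.@[x] * (b - G.@[x])); last by ring.
  by apply: idealD => //; [exact: ideal_Mr|exact: idealMl].
Qed.

Lemma graded_part_exp k a : (k <= N.+1)%N -> graded_part k a -> ideal_exp m k a.
Proof.
move=> kN [F [hF _ aF]]; apply: (ideal_congr (idE k) (mN_le kN aF)).
exact: homog_meval.
Qed.

Lemma graded_part_high k a : (N < k)%N -> graded_part k a -> mN a.
Proof.
move=> kN [F [hF _ aF]]; apply: (ideal_congr idN aF).
exact: ideal_exp_le (homog_meval hF).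
Qed.

(** This makes the sum of the graded parts direct: quasi-regularity puts the coefficients of the
    form into m, and elements of W in m lie in m^(N+1). *)
Lemma graded_part_vanish k a : graded_part k a -> ideal_exp m k.+1 a -> mN a.
Proof.
move=> ga ma; have [kN|kN] := ltnP N k; first exact: graded_part_high ga.
move: ga => [F [hF WF aF]]; apply: (ideal_congr idN aF).
rewrite meval_mon; apply: ideal_sum => // b _; apply: ideal_Mr => //; apply: Wm => //.
apply: (qreg hF).
rewrite -(subKr a F.@[x]); apply: idealB => //; exact: mN_le aF.
Qed.

Lemma graded_partW w : W w -> graded_part 0 w.
Proof.
move=> Ww; exists w%:MP; split.
- apply/dhomogP => a; rewrite msuppC; case: ifP => // _.
  by rewrite inE => /eqP->; exact: mdeg0.
- by move=> a; rewrite mcoeffC; case: (_ == _); rewrite ?mulr1 ?mulr0 //; exact: subring0.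
- by rewrite mevalC subrr; exact: ideal0.
Qed.

(** Replacing the coefficients of a form of degree k by representatives in W changes its value by an
    element of m^(k+1). *)
Lemma graded_part_lift k r : ideal_exp m k r ->
  exists2 v, graded_part k v & ideal_exp m k.+1 (r - v).
Proof.
move=> /(ideal_exp_homog idm mx genx)[F hF mF].
have [w wP] := @choice R R (fun r w => W w /\ m (r - w)) (fun r =>
  let: ex_intro2 w Ww mw := genW r in ex_intro _ w (conj Ww mw)).
pose G : {mpoly R[d]} := \sum_(a <- msupp F) w F@_a *: 'X_[a].
exists G.@[x].
  exists G; split; last by rewrite subrr; exact: ideal0.
    rewrite /G big_seq; apply: rpred_sum => a aF; apply: rpredZ; rewrite dhomogX.
    by apply/eqP; exact: (dhomogP _ _ _ hF).
  move=> a; rewrite /G raddf_sum; apply: subring_sum => // b _ /=.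
  rewrite mcoeffZ mcoeffX; apply: subringM => //; first by case: (wP F@_b).
  by case: (_ == _); [exact: subring1|exact: subring0].
apply: (ideal_trans (idE _) mF).
have -> : G.@[x] = \sum_(a <- msupp F) w F@_a * mon x a.
  by rewrite /G raddf_sum; apply: eq_bigr => a _; rewrite /= mevalZ mevalX.
rewrite meval_mon -sumrB; apply: ideal_sum_seq => // a aF; rewrite -mulrBl.
rewrite -[k.+1]add1n; apply: ideal_exp_mul => //; last first.
  by rewrite -(dhomogP _ _ _ hF _ aF); exact: ideal_exp_mon.
by apply/ideal_exp1 => //; case: (wP F@_a).
Qed.

Lemma horner1 (Q : {poly R}) n : (size Q <= n)%N -> Q.[1] = \sum_(k < n) Q`_k.
Proof.
move=> sQ; rewrite (horner_coef_wide _ sQ); apply: eq_bigr => k _.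
by rewrite expr1n mulr1.
Qed.

Lemma graded_exists r : exists2 Q, graded Q & mN (r - Q.[1]).
Proof.
suff [Q [gQ sQ mQ]] : exists Q, [/\ graded Q, (size Q <= N.+1)%N & mN (r - Q.[1])].
  by exists Q.
rewrite /mN; elim: N.+1 => [|k [Q [gQ sQ mQ]]].
  exists 0; split; rewrite ?size_poly0 // => k.
  by rewrite coef0; exact: graded_part0.
have [v gv mv] := graded_part_lift mQ.
exists (Q + v *: 'X^k); split.
- move=> l; rewrite coefD coefZ coefXn; apply: graded_partD => //.
  by case: eqP => [->|_]; rewrite ?mulr1 ?mulr0 //; exact: graded_part0.
- rewrite (leq_trans (size_polyD _ _)) // geq_max leqW //=.
  by rewrite (leq_trans (size_scale_leq _ _)) // size_polyXn.
- by rewrite hornerD hornerZ hornerXn expr1n mulr1 opprD addrA.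
Qed.

Lemma graded_unique Q : graded Q -> mN Q.[1] -> forall k, mN Q`_k.
Proof.
move=> gQ mQ; elim/ltn_ind => k IH; have [kN|kN] := ltnP N k.
  exact: graded_part_high (gQ k).
apply: (graded_part_vanish (gQ k)).
pose n := (k.+1 + size Q)%N; have kn : (k < n)%N by rewrite /n addSn ltnS leq_addr.
have := mQ; rewrite (@horner1 Q n) ?leq_addl // (bigD1 (Ordinal kn)) //=.
move=> /(mN_le (n := k.+1) kN) mS.
rewrite -(addrK (\sum_(i < n | i != Ordinal kn) Q`_i) Q`_k).
apply: (idealB (idE k.+1) mS); apply: (ideal_sum (idE k.+1)) => i ik.
case: (ltngtP i k) => [lt|gt|eq].
- by apply: mN_le => //; exact: IH.
- have [iN|iN] := ltnP N.+1 i; last first.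
    by apply: (ideal_exp_le idm gt); exact: graded_part_exp (gQ i).
  by apply: mN_le => //; apply: graded_part_high (gQ i); exact: ltnW.
- by case/eqP: ik; apply: val_inj.
Qed.

Lemma gradedB P Q : graded P -> graded Q -> graded (P - Q).
Proof. by move=> gP gQ k; rewrite coefB; exact: graded_partB. Qed.

Lemma gradedM P Q : graded P -> graded Q -> graded (P * Q).
Proof.
move=> gP gQ k; rewrite coefM; apply: (big_ind (graded_part k)).
- exact: graded_part0.
- by move=> a b; exact: graded_partD.
- by move=> i _; rewrite -{1}(subnKC (leq_ord i)); exact: graded_partM.
Qed.

Lemma gradedC w : W w -> graded w%:P.
Proof.
move=> Ww k; rewrite coefC; case: eqP => [->|_]; last exact: graded_part0.
exact: graded_partW.
Qed.

(* a higher derivation R -> A, packaged as a ring morphism R -> A[t] *)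
Lemma higher_derivation_exists :
  exists (A : comNzRingType) (phi : {rmorphism R -> {poly A}}),
  [/\ forall r, m r -> (phi r)`_0 = 0, forall a k, (phi (iota a))`_k.+1 = 0 &
      forall r, phi r = 0 -> mN r].
Proof.
have N1 : ~ mN 1.
  by move=> /(mN_le (n := 1) isT)/(ideal_exp1 _ idm); exact: (maximal_proper maxm).
have [A [pi [_ pi0]]] := quotient_exists idN N1.
have [f fP] := @choice R {poly R} (fun r Q => graded Q /\ mN (r - Q.[1])) (fun r =>
  let: ex_intro2 Q gQ mQ := graded_exists r in ex_intro _ Q (conj gQ mQ)).
pose phi r := map_poly pi (f r).
(* By uniqueness of components any decomposition of r computes [phi r]; this yields additivity and
   multiplicativity. *)
have phiE r Q : graded Q -> mN (r - Q.[1]) -> phi r = map_poly pi Q.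
  move=> gQ mQ; have [gf mf] := fP r.
  apply/polyP => k; rewrite !coef_map /=; apply/eqP; rewrite -subr_eq0 -rmorphB -coefB.
  apply/eqP/pi0/graded_unique; first exact: gradedB.
  rewrite hornerD hornerN (_ : _ - _ = (r - Q.[1]) - (r - (f r).[1])); last by ring.
  exact: idealB.
have phi_zmod : zmod_morphism phi.
  move=> r s; have [[gr mr] [gs ms]] := (fP r, fP s).
  rewrite (phiE _ (f r - f s)) ?rmorphB //; first exact: gradedB.
  rewrite hornerD hornerN (_ : _ - _ = (r - (f r).[1]) - (s - (f s).[1])); last by ring.
  exact: idealB.
have phi_monoid : monoid_morphism phi.
  split=> [|r s].
    rewrite (phiE _ 1%:P) ?rmorph1 //; last by rewrite hornerC subrr; exact: ideal0.
    by apply: gradedC; exact: subring1.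
  have [[gr mr] [gs ms]] := (fP r, fP s).
  rewrite (phiE _ (f r * f s)) ?rmorphM //; first exact: gradedM.
  rewrite hornerM.
  rewrite (_ : _ - _ = (r - (f r).[1]) * s + (f r).[1] * (s - (f s).[1])); last by ring.
  by apply: idealD => //; [exact: ideal_Mr|exact: idealMl].
pose Phi : {rmorphism R -> {poly A}} := HB.pack phi
  (GRing.isZmodMorphism.Build _ _ phi phi_zmod)
  (GRing.isMonoidMorphism.Build _ _ phi phi_monoid).
exists A, Phi; split=> [r mr|a k|r].
- have [gf mf] := fP r; rewrite /= coef_map /=; apply/pi0.
  apply: (graded_part_vanish (gf 0%N)); apply/ideal_exp1 => //.
  have := mN_le (n := 1) isT mf; rewrite (horner1 (n := (size (f r)).+1)) // big_ord_recl /=.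
  move=> /(ideal_exp1 _ idm); set S := \sum_(i < _) _ => mS.
  have -> : (f r)`_0 = r - (r - ((f r)`_0 + S)) - S by ring.
  apply: idealB => //; first exact: idealB.
  apply: ideal_sum => // i _; have [iN|iN] := ltnP N (bump 0 i).
    by apply/(ideal_exp1 _ idm)/(mN_le (n := 1) isT); exact: graded_part_high (gf _).
  apply/(ideal_exp1 _ idm); apply: (ideal_exp_le (n := bump 0 i) idm) => //.
  exact: graded_part_exp (leqW iN) (gf _).
- rewrite /= (phiE _ (iota a)%:P) ?map_polyC ?coefC //; first exact: gradedC.
  by rewrite hornerC subrr; exact: ideal0.
(* Setting t = 1 in [phi r] gives back the class of r. *)
- move=> /= phir; have [gf mf] := fP r; apply: (ideal_congr idN mf).
  apply/pi0; rewrite -horner_map -[map_poly _ _]/(phi r) phir horner0 //.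
Qed.

End Grading.

(** * Higher derivations and connections *)

Import monalg.

Section TensorLift.
Variables (R : nzRingType) (N M : lmodType R) (A : zmodType) (b : N -> M -> A).
Hypotheses (bDl : forall n n' x, b (n + n') x = b n x + b n' x)
  (bDr : forall n x x', b n (x + x') = b n x + b n x')
  (bZ : forall r n x, b (r *: n) x = b n (r *: x)).

Let lift_free (p : {malg int[(N * M)%type]}) : A :=
  \sum_(u <- msupp p) b u.1 u.2 *~ mcoeff u p.

Let lift_freeEw (d : {fset (N * M)%type}) p : (msupp p `<=` d)%fset ->
  lift_free p = \sum_(u <- d) b u.1 u.2 *~ mcoeff u p.
Proof.
move=> le; rewrite /lift_free (big_fset_incl _ le) // => u _ /mcoeff_outdom->.
by rewrite mulr0z.
Qed.

Let lift_freeB p q : lift_free (p - q) = lift_free p - lift_free q.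
Proof.
pose d := (msupp p `|` msupp q)%fset.
rewrite !(@lift_freeEw d) ?fsubsetUl ?fsubsetUr ?msuppB_le //.
by rewrite -sumrB; apply: eq_bigr => u _; rewrite mcoeffB mulrzBr.
Qed.

Let lift_free0 : lift_free 0 = 0.
Proof. by rewrite -[X in lift_free X](subrr 0) lift_freeB subrr. Qed.

Let lift_freeD p q : lift_free (p + q) = lift_free p + lift_free q.
Proof. by rewrite -[q in LHS]opprK -[- q]sub0r !lift_freeB lift_free0 sub0r opprK. Qed.

Let lift_freeU u : lift_free << u >> = b u.1 u.2.
Proof. by rewrite /lift_free msuppU oner_eq0 big_seq_fset1 mcoeffUU. Qed.

Let lift_free_null p : p \in tensor_nulls N M -> lift_free p = 0.
Proof.
move=> /asboolP[s [sP ->]]; rewrite big_seq; elim/big_ind: _ => //.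
  by move=> x y; rewrite lift_freeD => -> ->; rewrite addr0.
move=> c /sP rel; have c0 : lift_free c.2 = 0.
  case: rel => [n n' x|n x x'|r n x]; rewrite lift_freeB ?lift_freeD !lift_freeU /=.
  - by rewrite bDl subrr.
  - by rewrite bDr subrr.
  - by rewrite bZ subrr.
pose g : {additive {malg int[(N * M)%type]} -> A} :=
  HB.pack lift_free (GRing.isZmodMorphism.Build _ _ lift_free lift_freeB).
by rewrite -[c.1]intz scaler_int -[lift_free _]/(g _) raddfMz /= c0 mul0rz.
Qed.

Lemma tensor_lift : exists tau : {additive tensor N M -> A},
  forall n x, tau (tens n x) = b n x.
Proof.
pose tau t := lift_free (tensor_repr t).
have tauE p : tau (tensor_class p) = lift_free p.
  apply/eqP; rewrite -subr_eq0 -lift_freeB; apply/eqP/lift_free_null.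
  by apply/tensor_classP; exact: tensor_reprK.
have tauB : zmod_morphism tau.
  move=> x y; rewrite -[x]tensor_reprK -[y]tensor_reprK.
  by rewrite -(raddfB (@tensor_class _ _ _)) !tauE lift_freeB.
pose f : {additive tensor N M -> A} :=
  HB.pack tau (GRing.isZmodMorphism.Build _ _ tau tauB).
exists f => n x.
by rewrite /= tauE lift_freeU.
Qed.

End TensorLift.

Lemma tensor_ext (R : nzRingType) (N M : lmodType R) (A : zmodType)
    (f g : {additive tensor N M -> A}) :
  (forall n x, f (tens n x) = g (tens n x)) -> forall t, f t = g t.
Proof.
move=> fg t; rewrite -[t]tensor_reprK; set p := tensor_repr t.
rewrite [p]monalgE !raddf_sum; apply: eq_bigr => u _.
have -> : (<< mcoeff u p *g u >> : {malg int[(N * M)%type]}) = << u >> *~ mcoeff u p.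
  by rewrite -scaler_int intz; apply/malgP => v; rewrite mcoeffZ !mcoeffU;
    case: (u == v); rewrite ?mulr1n ?mulr0n ?mulr1 ?mulr0.
by rewrite !raddfMz /=; case: u => n x; congr (_ *~ _); exact: fg.
Qed.

(** * Evaluation of higher differentials along a higher derivation *)

Section OmegaEval.
Variables (K : fieldType) (R : comNzRingType) (iota : {rmorphism K -> R}).
Variables (A : comNzRingType) (phi : {rmorphism R -> {poly A}}).
Hypothesis phi_iota : forall a k, (phi (iota a))`_k.+1 = 0.

Local Notation mono := {cmonom (nat * R)%type}.

Definition phi0 (r : R) : A := (phi r)`_0.

Fact phi0_zmod : zmod_morphism phi0.
Proof. by move=> r s; rewrite /phi0 rmorphB coefB. Qed.

Fact phi0_monoid : monoid_morphism phi0.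
Proof.
by split=> [|r s]; rewrite /phi0 ?rmorph1 ?coef1 // rmorphM coefM big_ord1.
Qed.

HB.instance Definition _ := GRing.isZmodMorphism.Build R A phi0 phi0_zmod.
HB.instance Definition _ := GRing.isMonoidMorphism.Build R A phi0 phi0_monoid.

(** The variable (k, r) stands for the symbol of degree k + 1, whence the shift of the
    coefficient. *)
Definition mono_eval (u : mono) : A := \prod_(v <- finsupp u) (phi v.2)`_v.1.+1 ^+ u v.

Lemma mono_evalEw (u : mono) (d : {fset (nat * R)%type}) : (finsupp u `<=` d)%fset ->
  mono_eval u = \prod_(v <- d) (phi v.2)`_v.1.+1 ^+ u v.
Proof.
move=> le; rewrite /mono_eval (big_fset_incl _ le) // => v _.
by rewrite -cmE_neq0 negbK => /eqP->.
Qed.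

Fact mono_eval_mmorphism : mmorphism mono_eval.
Proof.
split=> [u v|]; last by rewrite /mono_eval mdom1 big_seq_fset0.
rewrite (@mono_evalEw u (finsupp (mmul u v))) ?mdomD ?fsubsetUl //.
rewrite (@mono_evalEw v (finsupp (mmul u v))) ?mdomD ?fsubsetUr //.
rewrite /mono_eval -mdomD -big_split; apply: eq_bigr => w _ /=.
by rewrite cmM exprD.
Qed.

HB.instance Definition _ :=
  monalg.isMultiplicative.Build mono A mono_eval mono_eval_mmorphism.

Definition poly_eval : {malg R[mono]} -> A := mmap phi0 mono_eval.
HB.instance Definition _ := GRing.RMorphism.on poly_eval.

Lemma poly_eval_symbol k r : poly_eval (hd_symbol k r) = (phi r)`_k.
Proof.
case: k => [|k] /=; first exact: mmapC.
rewrite /poly_eval mmapU /= rmorph1 mul1r /mono_eval mdomU big_seq_fset1.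
by rewrite cmUU expr1.
Qed.

Lemma poly_evalB p q : poly_eval (p - q) = poly_eval p - poly_eval q.
Proof. exact: rmorphB. Qed.

Lemma poly_evalD p q : poly_eval (p + q) = poly_eval p + poly_eval q.
Proof. exact: rmorphD. Qed.

Lemma poly_evalM p q : poly_eval (p * q) = poly_eval p * poly_eval q.
Proof. exact: rmorphM. Qed.

Lemma poly_eval_sum (I : Type) (s : seq I) (P : pred I) F :
  poly_eval (\sum_(i <- s | P i) F i) = \sum_(i <- s | P i) poly_eval (F i).
Proof. exact: rmorph_sum. Qed.

(* Rewriting with [poly_eval_symbol] would compare distinct symbols by
   conversion, which unfolds [hd_symbol] and explodes. *)
Lemma poly_eval_rel p : hd_rel iota p -> poly_eval p = 0.
Proof.
case=> [k r s|k a|k r s].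
- rewrite poly_evalB poly_evalD.
  transitivity ((phi (r + s))`_k.+1 - ((phi r)`_k.+1 + (phi s)`_k.+1)).
    by congr (_ - (_ + _)); exact: poly_eval_symbol.
  by rewrite (rmorphD phi) coefD subrr.
- exact: etrans (poly_eval_symbol _ _) _.
- rewrite poly_evalB poly_eval_sum.
  transitivity ((phi (r * s))`_k.+1 -
      \sum_(i < k.+2) (phi r)`_i * (phi s)`_(k.+1 - i)); last first.
    by rewrite (rmorphM phi) coefM subrr.
  congr (_ - _); first exact: poly_eval_symbol.
  apply: eq_bigr => i _; rewrite poly_evalM.
  by congr (_ * _); exact: poly_eval_symbol.
Qed.

Definition omega_eval (w : Omega iota) : A :=
  poly_eval (repr (w : {ideal_quot hd_ideal iota})).

Lemma omega_eval_class p : omega_eval (Omega_class iota p) = poly_eval p.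
Proof.
apply/eqP; rewrite -subr_eq0 -poly_evalB; apply/eqP.
set q := _ - _; have : q \in hd_ideal iota.
  rewrite /q Quotient.idealrBE; apply/eqP; exact: reprK.
move=> /asboolP[s [sP ->]]; rewrite poly_eval_sum big_seq big1 //.
move=> c /sP /poly_eval_rel c0.
by rewrite poly_evalM c0 mulr0.
Qed.

Lemma omega_class_surj (w : Omega iota) : exists p, w = Omega_class iota p.
Proof. by exists (repr (w : {ideal_quot hd_ideal iota})); exact: esym (reprK _). Qed.

Lemma omega_evalD w z : omega_eval (w + z) = omega_eval w + omega_eval z.
Proof.
have [[p ->] [q ->]] := (omega_class_surj w, omega_class_surj z).
by rewrite -(raddfD (@Omega_class K R iota)) !omega_eval_class poly_evalD.
Qed.

Lemma omega_evalM w z : omega_eval (w * z) = omega_eval w * omega_eval z.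
Proof.
have [[p ->] [q ->]] := (omega_class_surj w, omega_class_surj z).
by rewrite -(rmorphM (@Omega_class K R iota)) !omega_eval_class poly_evalM.
Qed.

Lemma omega_evalZ r (w : Omega iota) : omega_eval (r *: w) = phi0 r * omega_eval w.
Proof.
rewrite omega_evalM omega_eval_class; congr (_ * _).
exact: (poly_eval_symbol 0).
Qed.

End OmegaEval.

Section Connection.
Variables (K : fieldType) (R : comNzRingType) (iota : {rmorphism K -> R}).
Variables (A : comNzRingType) (phi : {rmorphism R -> {poly A}}).
Hypothesis phi_iota : forall a k, (phi (iota a))`_k.+1 = 0.
Variables (M : lmodType R) (nabla : M -> Omegahat_tensor iota M).
Hypothesis conn : higher_connection nabla.
Variable l : M -> A.
Hypotheses (lD : forall x y, l (x + y) = l x + l y)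
  (lZ : forall r x, l (r *: x) = phi0 phi r * l x).

(* By universality [phi] induces [Omega -> A]; composed with [l] it turns the
   connection into a higher derivation [M -> A[[t]]] over [phi]. *)
Lemma connection_derivation : exists psi : nat -> M -> A,
  [/\ forall k x y, psi k (x + y) = psi k x + psi k y,
      forall k r x, psi k (r *: x) = \sum_(i < k.+1) (phi r)`_i * psi (k - i)%N x &
      forall x, psi 0%N x = l x].
Proof.
have [nablaD nablaZ nabla0] := conn.
have [tau tauP] : exists tau : forall k, {additive tensor (Omega_ iota k) M -> A},
    forall k w x, tau k (tens w x) = omega_eval phi (Omega_val w) * l x.
  have ex_tau : forall k, exists f : {additive tensor (Omega_ iota k) M -> A},
      forall w x, f (tens w x) = omega_eval phi (Omega_val w) * l x.
    move=> k; apply: tensor_lift => [w w' x|w x y|r w x].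
    - by rewrite /= omega_evalD // mulrDl.
    - by rewrite lD mulrDr.
    - by rewrite /= omega_evalZ // lZ mulrCA mulrA.
  by exists (fun k => projT1 (cid (ex_tau k))) => k; exact: projT2 (cid (ex_tau k)).
have tau_mul k (i : 'I_k.+1) r t :
    tau k (tensor_map (Omega_mul (hd iota i r)) t) = (phi r)`_i * tau (k - i)%N t.
  pose f : {additive tensor (Omega_ iota (k - i)) M -> A} :=
    tau k \o tensor_map (Omega_mul (hd iota i r)).
  pose mul_tau s := (phi r)`_i * tau (k - i)%N s.
  have mul_tauB : zmod_morphism mul_tau by move=> s s'; rewrite /mul_tau raddfB mulrBr.
  pose g : {additive tensor (Omega_ iota (k - i)) M -> A} :=
    HB.pack mul_tau (GRing.isZmodMorphism.Build _ _ mul_tau mul_tauB).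
  apply: (tensor_ext (f := f) (g := g)) => w x.
  rewrite /= tensor_map_tens !tauP /= omega_evalM // omega_eval_class //.
  by rewrite poly_eval_symbol /mul_tau tauP mulrA.
exists (fun k x => tau k (nabla x k)); split=> [k x y|k r x|x].
- by rewrite nablaD raddfD.
- by rewrite nablaZ raddf_sum; apply: eq_bigr => i _; exact: tau_mul.
- by rewrite nabla0 tauP /= omega_eval_class // (poly_eval_symbol _ 0) rmorph1 coef1 mul1r.
Qed.

End Connection.

(** * Relations between local generators *)

Section LocalGenerators.
Variables (R : comNzRingType) (M : lmodType R) (m : R -> Prop).
Hypotheses (maxm : is_maximal m) (fgM : fg_module M).

(** Minimality of n does the work of Nakayama's lemma: a coefficient outside m in a relation would
    eliminate a generator, at the price of multiplying s by it. *)
Lemma minimal_local_generators : exists n (v : 'I_n -> M) (s : R),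
  [/\ ~ m s, forall x, exists c : 'I_n -> R, s *: x = \sum_i c i *: v i &
      forall c : 'I_n -> R, \sum_i c i *: v i = 0 -> forall i, m (c i)].
Proof.
pose P n := `[< exists (v : 'I_n -> M) (s : R),
  ~ m s /\ forall x, exists c : 'I_n -> R, s *: x = \sum_i c i *: v i >].
have exP : exists n, P n.
  have [n [g gP]] := fgM; exists n; apply/asboolP; exists g, 1.
  by split=> [|x]; [exact: maximal_proper|rewrite scale1r; exact: gP].
case: (ex_minnP exP) => n /asboolP[v [s [ns sP]]] nmin; exists n, v, s; split=> // c c0 i.
apply: contrapT => nc; case: n v sP nmin c c0 i nc => [|n] v sP nmin c c0 i nc.
  by case: i nc.
have /nmin : P n; last by rewrite ltnn.
apply/asboolP; exists (fun l => v (lift i l)), (c i * s); split.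
  by case/(primeM (maximal_is_prime maxm)).
move=> x; have [b bP] := sP x; exists (fun l => c i * b (lift i l) - b i * c (lift i l)).
under eq_bigr do rewrite scalerBl -!scalerA.
rewrite sumrB -!scaler_sumr -scalerA bP (bigD1_ord i) //= scalerDr.
have /eqP := c0; rewrite (bigD1_ord i) //= addrC addr_eq0 => /eqP->.
by rewrite scalerN opprK addrC !scalerA mulrC.
Qed.

Lemma local_coordinates (n : nat) (v : 'I_n -> M) (s : R) :
  (forall x, exists c : 'I_n -> R, s *: x = \sum_i c i *: v i) ->
  (forall c : 'I_n -> R, \sum_i c i *: v i = 0 -> forall i, c i = 0) ->
  exists l : M -> 'I_n -> R, (forall x, s *: x = \sum_i l x i *: v i) /\
    forall a x y i, l (a *: x + y) i = a * l x i + l y i.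
Proof.
move=> gen free; have [l lP] := choice gen; exists l; split=> // a x y i.
apply/eqP; rewrite -subr_eq0; apply/eqP.
apply: (free (fun i => l (a *: x + y) i - (a * l x i + l y i))).
under eq_bigr do rewrite scalerBl scalerDl -scalerA.
rewrite sumrB big_split /= -scaler_sumr -!lP scalerDr !scalerA mulrC.
by rewrite subrr.
Qed.

Variables (K : fieldType) (iota : {rmorphism K -> R}).
Variable nabla : M -> Omegahat_tensor iota M.
Hypothesis conn : higher_connection nabla.
Variables (A : comNzRingType) (phi : {rmorphism R -> {poly A}}).
Hypothesis phi_iota : forall a k, (phi (iota a))`_k.+1 = 0.
Hypothesis phi_m : forall r, m r -> (phi r)`_0 = 0.

(** Induction on the degree k in t. The component psi_k of the relation is a sum of products
    phi_a(c_i) psi_(k-a)(v_i), of which only those with a = k survive; if psi_0 is the j-th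
    coordinate, they add up to phi_k(c_j). *)
Lemma connection_relation n (v : 'I_n -> M) (s : R) : ~ m s ->
  (forall x, exists c : 'I_n -> R, s *: x = \sum_i c i *: v i) ->
  (forall c : 'I_n -> R, \sum_i c i *: v i = 0 -> forall i, m (c i)) ->
  forall c : 'I_n -> R, \sum_i c i *: v i = 0 -> forall i, phi (c i) = 0.
Proof.
move=> ns gen rel c c0; have idm := maximal_is_ideal maxm.
have [u mu] := maximal_inv maxm ns; have [b bP] := choice gen.
have phi0_eq p q : m (p - q) -> phi0 phi p = phi0 phi q.
  by move=> /phi_m pq; apply/eqP; rewrite -subr_eq0 -rmorphB; apply/eqP.
have bE x (e : 'I_n -> R) i : s *: x = \sum_i e i *: v i -> m (b x i - e i).
  move=> xe; apply: (rel (fun i => b x i - e i)).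
  by under eq_bigr do rewrite scalerBl; rewrite sumrB -xe -bP subrr.
suff H k : forall j, (phi (c j))`_k = 0.
  by move=> j; apply/polyP => k; rewrite coef0.
(* As u inverts s modulo m, l reads off the j-th coordinate in M/mM; b x j depends on the choice
   only modulo m, which [phi0] kills. *)
elim/ltn_ind: k => k IH j; pose l x := phi0 phi (u * b x j).
have lD x y : l (x + y) = l x + l y.
  rewrite /l -rmorphD; apply: phi0_eq; rewrite -mulrDr -mulrBr; apply: idealMl => //.
  apply: (bE _ (fun i => b x i + b y i)).
  by rewrite scalerDr !bP -big_split; apply: eq_bigr => i _; rewrite scalerDl.
have lZ r x : l (r *: x) = phi0 phi r * l x.
  rewrite /l -rmorphM; apply: phi0_eq; rewrite mulrCA -mulrBr; apply: idealMl => //.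
  apply: (bE _ (fun i => r * b x i)).
  by rewrite scalerA mulrC -scalerA bP scaler_sumr; apply: eq_bigr => i _; rewrite scalerA.
have lv i : l (v i) = (i == j)%:R.
  rewrite /l -(rmorph_nat (phi0 phi)); apply: phi0_eq.
  have bv : m (b (v i) j - s * (i == j)%:R).
    apply: (bE _ (fun t => s * (i == t)%:R)); rewrite (bigD1 i) //= eqxx mulr1.
    by rewrite big1 ?addr0 // => t; rewrite eq_sym => /negPf->; rewrite mulr0 scale0r.
  rewrite (_ : _ - _ =
    u * (b (v i) j - s * (i == j)%:R) - (1 - u * s) * (i == j)%:R); last by ring.
  by apply: idealB => //; [exact: idealMl|exact: ideal_Mr].
have [psi [psiD psiZ psi0]] := connection_derivation phi_iota conn lD lZ.
have psiDk := psiD k; have psi_0 : psi k 0 = 0.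
  by apply: (addrI (psi k 0)); rewrite -psiD !addr0.
have := congr1 (psi k) c0; rewrite psi_0 (big_morph (psi k) psiDk psi_0).
under eq_bigr do rewrite psiZ big_ord_recr /= subnn psi0 lv.
rewrite (bigD1 j) //= eqxx mulr1 big1 ?add0r; last first.
  by move=> a _; rewrite IH // mul0r.
rewrite big1 ?addr0 // => i ij; rewrite (negPf ij) mulr0 addr0.
by apply: big1 => a _; rewrite IH // mul0r.
Qed.

End LocalGenerators.

(** * Dual bases *)

Section DualBasis.
Variables (R : comNzRingType) (M : lmodType R).

(** For s = 1 this is a dual basis. Allowing other s makes the condition an ideal, which can be
    tested at each maximal ideal. *)
Definition factors_free (s : R) := exists n (l : 'I_n -> M -> R) (v : 'I_n -> M),
  (forall i a x y, l i (a *: x + y) = a * l i x + l i y) /\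
  forall x, s *: x = \sum_i l i x *: v i.

Lemma factors_free_ideal : is_ideal factors_free.
Proof.
split.
- exists 0%N, (fun=> fun=> 0), (fun=> 0); split=> [[]//|x].
  by rewrite big_ord0 scale0r.
- move=> s t [n [l [v [lL lv]]]] [k [l' [v' [lL' lv']]]].
  exists (n + k)%N, (fun i => match split i with inl i => l i | inr i => l' i end),
    (fun i => match split i with inl i => v i | inr i => v' i end); split.
    by move=> i a x y; case: (split i).
  move=> x; rewrite scalerDl lv lv' big_split_ord /=; congr (_ + _); apply: eq_bigr => i _.
    by rewrite (unsplitK (inl _)).
  by rewrite (unsplitK (inr _)).
- move=> r s [n [l [v [lL lv]]]]; exists n, (fun i x => r * l i x), v; split.
    by move=> i a x y; rewrite lL mulrDr mulrCA.
  by move=> x; rewrite -scalerA lv scaler_sumr; apply: eq_bigr => i _; rewrite scalerA.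
Qed.

Lemma factors_free_projective : factors_free 1 -> projective M.
Proof.
move=> [n [l [v [lL lv]]]] A B f g surj.
have [a aP] := choice (fun i => surj (g (v i))).
pose h x := \sum_i l i x *: a i.
have hL : linear h.
  move=> r x y; rewrite /h scaler_sumr -big_split; apply: eq_bigr => i _ /=.
  by rewrite lL scalerDl scalerA.
pose H : {linear M -> A} := HB.pack h (GRing.isLinear.Build R M A *:%R h hL).
exists H => x; rewrite /= /h linear_sum -[x in RHS]scale1r lv linear_sum.
by apply: eq_bigr => i _; rewrite !linearZZ aP.
Qed.

End DualBasis.

(** * Regular parameters *)

Lemma prime_idealr_of (R : comNzRingType) (P : R -> Prop) : is_prime P ->
  exists J : prime_idealr R, forall a, a \in J <-> P a.
Proof.
move=> [idP P1 PM]; have cl : idealr_closed (bool_ideal P).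
  split; first by apply/asboolP; exact: ideal0.
    by apply/asboolP.
  move=> a u v /asboolP Iu /asboolP Iv; apply/asboolP.
  by apply: idealD => //; exact: idealMl.
have pcl : prime_idealr_closed (bool_ideal P).
  by move=> u v /asboolP/PM[]?; apply/orP; [left|right]; apply/asboolP.
pose J : prime_idealr R := HB.pack (bool_ideal P) (isIdealr.Build R (bool_ideal P) cl)
  (isPrimeIdealrClosed.Build R (bool_ideal P) pcl).
by exists J => a; split=> [/asboolP|Ia]; last apply/asboolP.
Qed.

Section LocalizationPrimes.
Local Notation "x %:F" := (@FracField.tofrac _ x).
Variables (R : idomainType) (P : prime_idealr R).
Local Notation L := (localization P).

Fact fraction_proof (a s : R) : s \notin P -> a%:F / s%:F \in @localization_pred R P.
Proof. by move=> sP; apply/asboolP; exists a, s. Qed.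

Definition fraction_of (a s : R) (sP : s \notin P) : L := Localization (fraction_proof a sP).

Lemma notin1 : 1 \notin P. Proof. by rewrite idealr1. Qed.

Definition to_loc (a : R) : L := fraction_of a notin1.

Lemma to_locE a : localization_val (to_loc a) = a%:F.
Proof. by rewrite /= tofrac1 divr1. Qed.

Lemma to_loc0 : to_loc 0 = 0.
Proof. by apply: val_inj; rewrite /= tofrac0 mul0r. Qed.

Lemma to_loc1 : to_loc 1 = 1.
Proof. by apply: val_inj; rewrite /= tofrac1 divr1. Qed.

Lemma to_locD a b : to_loc (a + b) = to_loc a + to_loc b.
Proof. by apply: val_inj; rewrite /= tofracD mulrDl. Qed.

Lemma to_locM a b : to_loc (a * b) = to_loc a * to_loc b.
Proof. by apply: val_inj; rewrite /= tofracM tofrac1 !divr1. Qed.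

Lemma tofrac_notin (s : R) : s \notin P -> s%:F != 0 :> {fraction R}.
Proof. by rewrite tofrac_eq0; apply: contraNneq => ->; exact: idealr0. Qed.

Lemma loc_fraction (z : L) : exists a s, s \notin P /\ localization_val z = a%:F / s%:F.
Proof. by case: z => z /= /asboolP. Qed.

Lemma loc_mul_den (z : L) a s : s \notin P -> localization_val z = a%:F / s%:F ->
  to_loc s * z = to_loc a.
Proof.
move=> sP zE; apply: val_inj; rewrite /= zE tofrac1 !divr1 mulrC divfK //.
exact: tofrac_notin.
Qed.

Lemma loc_val_sum (I : Type) (r : seq I) (F : I -> L) :
  localization_val (\sum_(i <- r) F i) = \sum_(i <- r) localization_val (F i).
Proof. exact: (big_morph (@localization_val R P) (id1 := 0) (op1 := +%R)). Qed.

Lemma to_loc_unit s : s \notin P -> exists z, to_loc s * z = 1.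
Proof. by move=> sP; exists (fraction_of 1 sP); rewrite (@loc_mul_den _ 1 s) ?to_loc1. Qed.

Lemma contraction_sub (Q : idealr L) a : to_loc a \in Q -> a \in P.
Proof.
apply: contraTT => /to_loc_unit[z az]; apply/negP => aQ.
by have := idealr1 Q; rewrite -az mulrC idealMr.
Qed.

Lemma contraction_prime (Q : prime_idealr L) : is_prime (fun a => to_loc a \in Q).
Proof.
split; first split.
- by rewrite to_loc0 idealr0.
- by move=> a b aQ bQ; rewrite to_locD rpredD.
- by move=> r a aQ; rewrite to_locM idealMr.
- by rewrite to_loc1 idealr1.
- by move=> a b; rewrite to_locM prime_idealrM => /orP.
Qed.

(** Denominators are units of R_P, so a fraction lies in the same primes as its numerator, and
    strictness survives contraction. *)
Lemma contraction_lt (Q Q' : prime_idealr L) : prime_lt Q Q' ->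
  (forall a, to_loc a \in Q -> to_loc a \in Q') /\
  exists2 a, to_loc a \in Q' & ~ to_loc a \in Q.
Proof.
move=> [QQ' nQ]; split=> [a /QQ'//|]; apply: contrapT => nex; apply: nQ => z zQ'.
have [a [s [sP zE]]] := loc_fraction z; have sz := loc_mul_den sP zE.
apply: contrapT => nz; apply: nex; exists a; first by rewrite -sz idealMr.
rewrite -sz prime_idealrM => /orP[/contraction_sub|//].
by apply/negP.
Qed.

(** The extension of P contains every proper ideal of R_P, since numerators outside P give units;
    hence the maximal ideal m' equals it. *)
Lemma maximal_contains (m' : idealr L) a : maximal_ideal m' -> a \in P -> to_loc a \in m'.
Proof.
move=> maxm' aP.
pose I (z : L) := exists b s, [/\ b \in P, s \notin P & localization_val z = b%:F / s%:F].
have nM s t : s \notin P -> t \notin P -> s * t \notin P.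
  by move=> sP tP; rewrite prime_idealrM negb_or sP.
have idI : is_ideal I.
  split.
  - by exists 0, 1; split; rewrite ?idealr0 ?idealr1 //= tofrac0 mul0r.
  - move=> z w [b [s [bP sP zE]]] [c [t [cP tP wE]]]; exists (b * t + c * s), (s * t).
    split; [|exact: nM|].
      by rewrite rpredD // mulrC idealMr.
    by rewrite /= zE wE addf_div ?tofrac_notin // tofracD !tofracM.
  - move=> r z [b [s [bP sP zE]]]; have [c [t [tP rE]]] := loc_fraction r.
    exists (c * b), (t * s); split; [exact: idealMr|exact: nM|].
    by rewrite /= rE zE mulf_div !tofracM.
have I1 : ~ I 1.
  move=> [b [s [bP sP]]] /= E; case/negP: (sP); suff -> : s = b by [].
  apply/eqP; rewrite -tofrac_eq; apply/eqP.
  by rewrite -[LHS]mul1r E divfK // tofrac_notin.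
have [J JI] := idealr_of idI I1; apply: (maxm' J); last first.
  by apply/JI; exists a, 1; split; rewrite ?idealr1.
move=> z zm; apply/JI; have [b [s [sP zE]]] := loc_fraction z; exists b, s; split=> //.
by apply: (@contraction_sub m'); rewrite -(loc_mul_den sP zE) mulrC mulrC idealMr.
Qed.

End LocalizationPrimes.

(** The x_i are numerators of d generators of the maximal ideal of R_m. In R they generate m only
    after multiplication by a common denominator S outside m, which is inverted modulo m^2. The
    primes are contracted from a chain in R_m, whose length is also d by regularity. *)
Lemma regular_parameters (R : idomainType) (m : R -> Prop) :
  regular_ring R -> is_maximal m -> exists d (x : 'I_d -> R) (P : nat -> R -> Prop),
  [/\ forall i, m (x i),
      forall a, m a -> exists c : 'I_d -> R, ideal_exp m 2 (a - \sum_i c i * x i),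
      forall i, (i <= d)%N -> is_prime (P i) /\ forall a, P i a -> m a &
      forall i, (i < d)%N -> (forall a, P i a -> P i.+1 a) /\
        exists2 z, P i.+1 z & ~ P i z].
Proof.
move=> [_ reg] maxm; have idm := maximal_is_ideal maxm.
have [Q QP] := prime_idealr_of (maximal_is_prime maxm).
have [_ [m' [maxm' _ [d [y [[[C CP] _] genm']]]]]] := reg Q.
have ym' i : y i \in m'.
  apply/genm'; exists (fun j => (j == i)%:R).
  by rewrite (bigD1 i) //= eqxx mul1r big1 ?addr0 // => j /negPf->; rewrite mul0r.
have [b bP] := choice (fun i => loc_fraction (y i)).
have [t tP] := choice bP.
exists d, b, (fun i a => to_loc Q a \in C (inord i)); split.
- move=> i; apply/QP/(@contraction_sub _ _ m').
  by have [tQ yE] := tP i; rewrite -(loc_mul_den tQ yE) idealMr.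
- move=> a /QP aQ; have /genm'[c aE] := maximal_contains maxm' aQ.
  have [f fP] := choice (fun i => loc_fraction (c i)); have [g gP] := choice fP.
  pose S := \prod_i (t i * g i).
  have nS : ~ m S.
    rewrite /S; elim/big_ind: _ => [|u v nu nv|i _]; first exact: maximal_proper.
      by case/(primeM (maximal_is_prime maxm)).
    case/(primeM (maximal_is_prime maxm)) => /QP; apply/negP.
      by case: (tP i).
    by case: (gP i).
  have SE : S * a = \sum_i (f i * \prod_(j | j != i) (t j * g j)) * b i.
    apply/eqP; rewrite -tofrac_eq; apply/eqP.
    have := congr1 (@localization_val _ _) aE; rewrite to_locE tofracM => ->.
    rewrite loc_val_sum mulr_sumr rmorph_sum; apply: eq_bigr => i _ /=.
    have [[tQ yE] [gQ cE]] := (tP i, gP i).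
    rewrite yE cE /S (bigD1 i) //= !tofracM mulf_div.
    set p := FracField.tofrac (\prod_(_ | _) _).
    have tn := tofrac_notin tQ; have gn := tofrac_notin gQ.
    by field; rewrite tn.
  have [u mu] := maximal_inv_exp 2 maxm nS.
  exists (fun i => u * (f i * \prod_(j | j != i) (t j * g j))).
  have -> : \sum_i u * (f i * \prod_(j | j != i) (t j * g j)) * b i = u * (S * a).
    by rewrite SE mulr_sumr; apply: eq_bigr => i _; rewrite -!mulrA.
  rewrite mulrA -{1}[a]mul1r -mulrBl; apply: ideal_Mr => //.
  exact: ideal_exp_ideal.
- move=> i id; split; first exact: contraction_prime.
  by move=> a /contraction_sub/QP.
- move=> i id; apply: contraction_lt; apply: CP.
  by rewrite !inordK // ltnS // ltnW.
Qed.

Lemma fg_algebra_gen (K : fieldType) (R : comNzRingType) (iota : {rmorphism K -> R}) :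
  fg_algebra iota -> exists ys, ring_gen iota ys.
Proof.
move=> [n [x xP]]; exists [seq x i | i <- enum 'I_n] => S ringS Siota Sx r.
have [p ->] := xP r; apply: subring_sum => // a _; apply: subringM => //.
apply: (big_ind S) => [|u v|i _]; [exact: subring1|exact: subringM|].
by apply: subringX => //; apply: Sx; apply: map_f; rewrite mem_enum.
Qed.

Lemma higher_derivation_at (K : fieldType) (R : idomainType) (iota : {rmorphism K -> R})
    (m : R -> Prop) (N : nat) :
  perfect_field K -> fg_algebra iota -> regular_ring R -> is_maximal m ->
  exists (A : comNzRingType) (phi : {rmorphism R -> {poly A}}),
  [/\ forall r, m r -> (phi r)`_0 = 0, forall a k, (phi (iota a))`_k.+1 = 0 &
      forall r, phi r = 0 -> ideal_exp m N.+1 r].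
Proof.
move=> perfK /fg_algebra_gen[ys gen] regR maxm.
have [algm [e [y geny]]] := residue_field gen maxm.
have [d [x [P [mx genx primeP ltP]]]] := regular_parameters regR maxm.
have [W [coefW genW]] := coef_ring_exists perfK maxm algm N gen.
apply: (higher_derivation_exists maxm mx genx _ coefW genW) => F k hF mF.
by apply: (quasi_regular maxm mx genx geny _ primeP ltP hF mF); case: regR.
Qed.

Theorem corollary4p5 (K : fieldType) (R : idomainType)
    (iota : {rmorphism K -> R}) (M : lmodType R)
    (nabla : M -> Omegahat_tensor iota M) :
  perfect_field K ->
  fg_algebra iota ->
  regular_ring R ->
  fg_module M ->
  higher_connection nabla ->
  projective M.
Proof.
move=> perfK fgR regR fgM conn; apply: factors_free_projective; apply: contrapT => nfree.
have [m maxm mfree] := maximal_above (@factors_free_ideal R M) nfree.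
have idm := maximal_is_ideal maxm.
have [n [v [s [ns gen rel]]]] := minimal_local_generators maxm fgM.
have free c : \sum_i c i *: v i = 0 -> forall i, c i = 0.
  move=> c0 i; apply: contrapT => /eqP ci.
  have [noethR _] := regR.
  (* The exponent 0 is excluded because m^0 is the whole ring. *)
  have [[|N] nm] := krull_intersection noethR idm (maximal_proper maxm) ci.
    by case: nm.
  have [A [phi [phi_m phi_iota phi_inj]]] := higher_derivation_at N perfK fgR regR maxm.
  apply: nm; apply: phi_inj.
  exact: (connection_relation maxm conn phi_iota phi_m ns gen rel c0).
(* Freeness makes the coordinates of s x linear in x, so s itself satisfies [factors_free] and would
   lie in m. *)
apply: ns; apply: mfree; have [l [lv lL]] := local_coordinates gen free.
exists n, (fun i x => l x i), v; split=> [i a x y|x]; [exact: lL|exact: lv].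
Qed.
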